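(* Consider the control system $\dot q=0,\ \dot z=f(q,z,\omega)$, $(q,z)\in\mathbb{X}$, with control $\omega\in\mathbb{R}^m$ and $f:\mathbb{X}\times\mathbb{R}^m\to\mathbb{R}^n$ continuous. Let $\mathcal{Y}\subset\mathbb{X}$ be closed, let $\mathcal{A}\subset\mathcal{Y}$ be compact, let $\mathcal{B}:=\{(q,z)\in\mathbb{X}:\exists s\in Q,\ (s,z)\in\mathcal{A}\}$, and let $\delta:\mathbb{X}\to\mathbb{R}_{\ge0}$ be continuous and positive on $\mathbb{X}\setminus\mathcal{A}$. Let $(V,\kappa)$ be a synergistic Lyapunov function and feedback (SLFF) pair for this system relative to $(\mathcal{A},\mathcal{Y})$, and define $$C:=\{(q,z)\in\mathbb{X}:\mu_V(q,z)\le\delta(q,z)\},\qquad D:=\{(q,z)\in\mathbb{X}:\mu_V(q,z)\ge\delta(q,z)\},$$ $$G_c(z):=\{g_c\in Q:\mu_V(g_c,z)=0\},$$ and the closed-loop hybrid system $$\dot q=0,\quad\dot z=f(q,z,\kappa(q,z))\quad\text{for }(q,z)\in C;\qquad q^+\in G_c(z),\quad z^+=z\quad\text{for }(q,z)\in D. \qquad(\mathcal H)$$ (i) If the synergy gap of $(V,\kappa)$ exceeds $\delta$, then $\mathcal{A}\subset C$ and $\mathcal{A}$ is globally asymptotically stable for $(\mathcal H)$. (ii) If the synergy gap of $(V,\kappa)$ totally exceeds $\delta$, then $\mathcal{A}\subset C$ and $\mathcal{B}$ is globally asymptotically stable for $(\mathcal H)$.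
   Context: **Setting.** $Q\subset\mathbb{R}$ is a finite set and $\mathbb{X}\subset Q\times\mathbb{R}^n$ is closed. For a $C^1$ function $V$ on $\mathbb{X}$, $\nabla V(q,z)$ is the gradient with respect to $z$ with $q$ held constant. **SLFF pairs.** Let $\mathcal{A}\subset\mathcal{Y}\subset\mathbb{X}$ with $\mathcal{A}$ compact and $\mathcal{Y}$ closed, and let $\mathcal{B}:=\{(q,z)\in\mathbb{X}:\exists s\in Q,\ (s,z)\in\mathcal{A}\}$. A $C^1$ function $V:\mathbb{X}\to\mathbb{R}_{\ge0}$ and a continuous function $\kappa:\mathbb{X}\to\mathbb{R}^m$ form an *SLFF pair candidate* relative to $(\mathcal{A},\mathcal{Y})$ for $\dot q=0,\dot z=f(q,z,\omega)$ if: $\{(q,z)\in\mathbb{X}:V(q,z)\le c\}$ is compact for each $c\ge0$; $V(q,z)=0$ if and only if $(q,z)\in\mathcal{A}$; and $\langle\nabla V(q,z),f(q,z,\kappa(q,z))\rangle\le0$ for all $(q,z)\in\mathcal{Y}$. Given such a candidate, let $\mathcal{E}:=\{(q,z)\in\mathcal{Y}:\langle\nabla V(q,z),f(q,z,\kappa(q,z))\rangle=0\}$ and let $\Psi\subset\mathcal{E}$ be the largest weakly invariant set for the system $\dot q=0,\ \dot z=f(q,z,\kappa(q,z))$, $(q,z)\in\mathcal{E}$. For each $(q,z)\in\mathbb{X}$ let $\mu_V(q,z):=V(q,z)-\min_{s\in Q}V(s,z)$. The pair $(V,\kappa)$ is an *SLFF pair relative to $(\mathcal{A},\mathcal{Y})$*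 if it is a candidate and $\mu_V(q,z)>0$ for all $(q,z)\in(\Psi\cup\overline{\mathbb{X}\setminus\mathcal{Y}})\setminus\mathcal{A}$; then $\mu_V(q,z)$ is called the *synergy gap* at $(q,z)$. For continuous $\delta:\mathbb{X}\to\mathbb{R}_{\ge0}$, the synergy gap *exceeds* $\delta$ if $\mu_V(q,z)>\delta(q,z)$ for all $(q,z)\in(\Psi\cup\overline{\mathbb{X}\setminus\mathcal{Y}})\setminus\mathcal{A}$, and *totally exceeds* $\delta$ if $\mu_V(q,z)>\delta(q,z)$ for all $(q,z)\in(\Psi\cup\overline{\mathbb{X}\setminus\mathcal{Y}}\cup\mathcal{B})\setminus\mathcal{A}$. **Weak invariance.** For a constrained differential equation $\dot x=F(x)$, $x\in S$ (solutions are locally absolutely continuous, satisfy the equation almost everywhere and stay in $S$), a set $M\subset S$ is weakly invariant if (forward) for each $x_0\in M$ there is a solution on $[0,\infty)$ starting at $x_0$ and staying in $M$, and (backward) for each $x^*\in M$ and $N>0$ there are $T\ge N$ and a solution $x:[0,T]\to M$ with $x(T)=x^*$. **Hybrid systems.** Solutions of hybrid systems are defined on hybrid time domains in the sense of Goebel–Sanfelice–Teel. A compact set is *globally asymptotically stable* if it is (Lyapunov) stable, all solutions are bounded, and every complete solution converges to it. *)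

(* Defs.v *)
From HB Require Import structures.
From mathcomp Require Import all_boot all_order all_algebra finmap.
From mathcomp Require Import all_classical all_reals all_analysis.

Set Implicit Arguments.
Unset Strict Implicit.
Unset Printing Implicit Defensive.

Import Order.TTheory GRing.Theory Num.Theory.
Import numFieldNormedType.Exports.

Local Open Scope classical_set_scope.
Local Open Scope ring_scope.

Definition abs_continuous (R : realType) (W : normedModType R) (a b : R)
    (x : R -> W) : Prop :=
  forall e : R, 0 < e -> exists2 d : R, 0 < d &
    forall (N : nat) (s t : nat -> R),
      (forall i, (i < N)%N -> [/\ a <= s i, s i <= t i & t i <= b]) ->
      trivIset `I_N (fun i => `]s i, t i[%classic) ->
      \sum_(i < N) (t i - s i) < d ->
      \sum_(i < N) `|x (t i) - x (s i)| < e.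

Definition loc_abs_continuous (R : realType) (W : normedModType R)
    (I : set R) (x : R -> W) : Prop :=
  forall a b : R, `[a, b]%classic `<=` I -> abs_continuous a b x.

(* The trajectory [x] is total but only its values on the interval [I] matter:
   an interval differs from its interior by a null set, and the derivative at
   an interior point is determined by the values on [I]. *)
Definition ode_solution (R : realType) (W : normedModType R)
    (F : W -> W) (S : set W) (I : set R) (x : R -> W) : Prop :=
  [/\ loc_abs_continuous I x,
      {ae @lebesgue_measure R, forall t, I t -> is_derive t 1 x (F (x t))} &
      forall t, I t -> S (x t)].

Definition weakly_forward_invariant (R : realType) (W : normedModType R)
    (F : W -> W) (S M : set W) : Prop :=
  forall x0, M x0 -> exists x : R -> W,
    [/\ ode_solution F S `[0, +oo[%classic x, x 0 = x0 &
        forall t, 0 <= t -> M (x t)].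

Definition weakly_backward_invariant (R : realType) (W : normedModType R)
    (F : W -> W) (S M : set W) : Prop :=
  forall (x1 : W) (N : R), M x1 -> 0 < N -> exists (T : R) (x : R -> W),
    [/\ N <= T, ode_solution F S `[0, T]%classic x,
        forall t, 0 <= t <= T -> M (x t) & x T = x1].

Definition weakly_invariant (R : realType) (W : normedModType R)
    (F : W -> W) (S M : set W) : Prop :=
  [/\ M `<=` S, weakly_forward_invariant F S M &
      weakly_backward_invariant F S M].

Definition largest_weakly_invariant (R : realType) (W : normedModType R)
    (F : W -> W) (S : set W) : set W :=
  \bigcup_(M in [set M | weakly_invariant F S M]) M.

Lemma largest_weakly_invariantP (R : realType) (W : normedModType R)
    (F : W -> W) (S : set W) :
  weakly_invariant F S (largest_weakly_invariant F S) /\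
  forall M, weakly_invariant F S M -> M `<=` largest_weakly_invariant F S.
Proof.
split; last by move=> M wM x Mx; exists M.
split.
- by move=> x [M [MS _ _]] /MS.
- move=> x0 [M wM Mx0]; have [_ fwd _] := wM.
  have [x [solx x00 xM]] := fwd _ Mx0.
  by exists x; split => // t t0; exists M => //; exact: xM.
- move=> x1 N [M wM Mx1] N0; have [_ _ bwd] := wM.
  have [T [x [NT solx xM xT]]] := bwd _ _ Mx1 N0.
  by exists T, x; split => // t tT; exists M => //; exact: xM.
Qed.

Record hybrid_system (W : Type) := HybridSystem {
  flow_set : set W ;
  flow_map : W -> W ;
  jump_set : set W ;
  jump_map : W -> set W }.

Definition compact_hybrid_time_domain (R : realType) (E : set (R * nat)) :
    Prop :=
  exists (J : nat) (t : nat -> R),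
    [/\ t 0%N = 0, forall j, (j < J)%N -> t j <= t j.+1 &
        E = \bigcup_(j in `I_J) (`[t j, t j.+1]%classic `*` [set j])].

Definition hybrid_time_domain (R : realType) (E : set (R * nat)) : Prop :=
  (forall p, E p -> 0 <= p.1) /\
  forall T J, E (T, J) ->
    compact_hybrid_time_domain
      (E `&` (`[0, T]%classic `*` [set j | (j <= J)%N])).

(* A hybrid arc is a total function [phi] together with its domain [E];
   [phi t j] is irrelevant for [(t, j)] outside [E]. *)
Definition hybrid_solution (R : realType) (W : normedModType R)
    (H : hybrid_system W) (E : set (R * nat)) (phi : R -> nat -> W) : Prop :=
  let I j : set R := [set t | E (t, j)] in
  [/\ hybrid_time_domain E,
      E (0, 0%N) /\ (closure (flow_set H) `|` jump_set H) (phi 0 0%N),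
      forall j, loc_abs_continuous (I j) (phi ^~ j),
      forall j,
        (forall t, (I j)° t -> flow_set H (phi t j)) /\
        {ae @lebesgue_measure R, forall t, I j t ->
           is_derive t 1 (phi ^~ j) (flow_map H (phi t j))} &
      forall t j, E (t, j) -> E (t, j.+1) ->
        jump_set H (phi t j) /\ jump_map H (phi t j) (phi t j.+1)].

Definition complete_domain (R : realType) (E : set (R * nat)) : Prop :=
  forall N : R, exists t j, E (t, j) /\ N <= t + j%:R.

Definition lyapunov_stable (R : realType) (W : normedModType R)
    (H : hybrid_system W) (K : set W) : Prop :=
  forall e : R, 0 < e -> exists2 d : R, 0 < d &
    forall E phi, hybrid_solution H E phi ->
      (edist_inf K (phi 0%R 0%N) <= d%:E)%E ->
      forall t j, E (t, j) -> (edist_inf K (phi t j) <= e%:E)%E.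

Definition solutions_bounded (R : realType) (W : normedModType R)
    (H : hybrid_system W) : Prop :=
  forall E phi, hybrid_solution H E phi ->
    exists M : R, forall t j, E (t, j) -> `|phi t j| <= M.

Definition globally_attractive (R : realType) (W : normedModType R)
    (H : hybrid_system W) (K : set W) : Prop :=
  forall E phi, hybrid_solution H E phi -> complete_domain E ->
    forall e : R, 0 < e -> exists N : R, forall t j, E (t, j) ->
      N <= t + j%:R -> (edist_inf K (phi t j) <= e%:E)%E.

Definition globally_asymptotically_stable (R : realType)
    (W : normedModType R) (H : hybrid_system W) (K : set W) : Prop :=
  [/\ compact K, lyapunov_stable H K, solutions_bounded H &
      globally_attractive H K].

(* States [(q, z)] live in [R * 'rV[R]_n]. *)

Definition grad_z (R : realType) (n : nat) (V : R * 'rV[R]_n -> R)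
    (x : R * 'rV[R]_n) : 'rV[R]_n :=
  \row_i 'D_(delta_mx 0 i) (fun z => V (x.1, z)) x.2.

Definition inner (R : realType) (n : nat) (u v : 'rV[R]_n) : R :=
  \sum_i u 0 i * v 0 i.

(* A function is C^1 on a closed subset of Q * R^n when it is C^1 in z on a
   neighbourhood of that subset in Q * R^n; [V] is such an extension, and its
   values away from that neighbourhood are irrelevant. *)
Definition C1_on (R : realType) (n : nat) (Q : {fset R})
    (X : set (R * 'rV[R]_n)) (V : R * 'rV[R]_n -> R) : Prop :=
  exists O : set (R * 'rV[R]_n),
    let OQ := O `&` [set x | x.1 \in Q] in
    [/\ open O, X `<=` O,
        forall x, OQ x -> differentiable (fun z => V (x.1, z)) x.2 &
        {within OQ, continuous (grad_z V)}].

Definition closed_loop (R : realType) (n m : nat)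
    (f : (R * 'rV[R]_n) * 'rV[R]_m -> 'rV[R]_n)
    (kappa : R * 'rV[R]_n -> 'rV[R]_m) (x : R * 'rV[R]_n) : R * 'rV[R]_n :=
  (0, f (x, kappa x)).

Definition Vdot (R : realType) (n m : nat)
    (f : (R * 'rV[R]_n) * 'rV[R]_m -> 'rV[R]_n)
    (V : R * 'rV[R]_n -> R) (kappa : R * 'rV[R]_n -> 'rV[R]_m)
    (x : R * 'rV[R]_n) : R :=
  inner (grad_z V x) (f (x, kappa x)).

Definition slff_candidate (R : realType) (n m : nat) (Q : {fset R})
    (X : set (R * 'rV[R]_n)) (f : (R * 'rV[R]_n) * 'rV[R]_m -> 'rV[R]_n)
    (A Y : set (R * 'rV[R]_n))
    (V : R * 'rV[R]_n -> R) (kappa : R * 'rV[R]_n -> 'rV[R]_m) : Prop :=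
  [/\ C1_on Q X V /\ (forall x, X x -> 0 <= V x),
      {within X, continuous kappa},
      forall c, 0 <= c -> compact (X `&` [set x | V x <= c]),
      forall x, X x -> (V x = 0 <-> A x) &
      forall x, Y x -> Vdot f V kappa x <= 0].

Definition zero_dissipation_set (R : realType) (n m : nat)
    (f : (R * 'rV[R]_n) * 'rV[R]_m -> 'rV[R]_n) (Y : set (R * 'rV[R]_n))
    (V : R * 'rV[R]_n -> R) (kappa : R * 'rV[R]_n -> 'rV[R]_m) :
    set (R * 'rV[R]_n) :=
  Y `&` [set x | Vdot f V kappa x = 0].

Definition Psi (R : realType) (n m : nat)
    (f : (R * 'rV[R]_n) * 'rV[R]_m -> 'rV[R]_n) (Y : set (R * 'rV[R]_n))
    (V : R * 'rV[R]_n -> R) (kappa : R * 'rV[R]_n -> 'rV[R]_m) :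
    set (R * 'rV[R]_n) :=
  largest_weakly_invariant (closed_loop f kappa)
    (zero_dissipation_set f Y V kappa).

(* The iterated minimum is seeded with [V x], which changes nothing when
   [x.1 \in Q].  The minimum runs over all of [Q], so it concerns a function
   [V] on X only if X contains every (s, z) with s in Q as soon as it contains
   some (q, z); see [fiber_closed]. *)
Definition mu (R : realType) (n : nat) (Q : {fset R})
    (V : R * 'rV[R]_n -> R) (x : R * 'rV[R]_n) : R :=
  V x - \big[Num.min/V x]_(s <- Q) V (s, x.2).

Definition fiber_closed (R : realType) (n : nat) (Q : {fset R})
    (X : set (R * 'rV[R]_n)) : Prop :=
  forall q z s, X (q, z) -> s \in Q -> X (s, z).

Definition gap_region (R : realType) (n m : nat) (X : set (R * 'rV[R]_n))
    (f : (R * 'rV[R]_n) * 'rV[R]_m -> 'rV[R]_n) (Y : set (R * 'rV[R]_n))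
    (V : R * 'rV[R]_n -> R) (kappa : R * 'rV[R]_n -> 'rV[R]_m) :
    set (R * 'rV[R]_n) :=
  Psi f Y V kappa `|` closure (X `\` Y).

Definition slff_pair (R : realType) (n m : nat) (Q : {fset R})
    (X : set (R * 'rV[R]_n)) (f : (R * 'rV[R]_n) * 'rV[R]_m -> 'rV[R]_n)
    (A Y : set (R * 'rV[R]_n))
    (V : R * 'rV[R]_n -> R) (kappa : R * 'rV[R]_n -> 'rV[R]_m) : Prop :=
  slff_candidate Q X f A Y V kappa /\
  forall x, (gap_region X f Y V kappa `\` A) x -> 0 < mu Q V x.

Definition Bset (R : realType) (n : nat) (Q : {fset R})
    (X A : set (R * 'rV[R]_n)) : set (R * 'rV[R]_n) :=
  X `&` [set x | exists2 s, s \in Q & A (s, x.2)].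

Definition gap_exceeds (R : realType) (n m : nat) (Q : {fset R})
    (X : set (R * 'rV[R]_n)) (f : (R * 'rV[R]_n) * 'rV[R]_m -> 'rV[R]_n)
    (A Y : set (R * 'rV[R]_n))
    (V : R * 'rV[R]_n -> R) (kappa : R * 'rV[R]_n -> 'rV[R]_m)
    (delta : R * 'rV[R]_n -> R) : Prop :=
  forall x, (gap_region X f Y V kappa `\` A) x -> delta x < mu Q V x.

Definition gap_totally_exceeds (R : realType) (n m : nat) (Q : {fset R})
    (X : set (R * 'rV[R]_n)) (f : (R * 'rV[R]_n) * 'rV[R]_m -> 'rV[R]_n)
    (A Y : set (R * 'rV[R]_n))
    (V : R * 'rV[R]_n -> R) (kappa : R * 'rV[R]_n -> 'rV[R]_m)
    (delta : R * 'rV[R]_n -> R) : Prop :=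
  forall x, ((gap_region X f Y V kappa `|` Bset Q X A) `\` A) x ->
    delta x < mu Q V x.

Definition Cset (R : realType) (n : nat) (Q : {fset R})
    (X : set (R * 'rV[R]_n)) (V delta : R * 'rV[R]_n -> R) :
    set (R * 'rV[R]_n) :=
  X `&` [set x | mu Q V x <= delta x].

Definition Dset (R : realType) (n : nat) (Q : {fset R})
    (X : set (R * 'rV[R]_n)) (V delta : R * 'rV[R]_n -> R) :
    set (R * 'rV[R]_n) :=
  X `&` [set x | delta x <= mu Q V x].

Definition Gc (R : realType) (n : nat) (Q : {fset R})
    (V : R * 'rV[R]_n -> R) (z : 'rV[R]_n) : set R :=
  [set g | g \in Q /\ mu Q V (g, z) = 0].

Definition closed_loop_hybrid (R : realType) (n m : nat) (Q : {fset R})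
    (X : set (R * 'rV[R]_n)) (f : (R * 'rV[R]_n) * 'rV[R]_m -> 'rV[R]_n)
    (V : R * 'rV[R]_n -> R) (kappa : R * 'rV[R]_n -> 'rV[R]_m)
    (delta : R * 'rV[R]_n -> R) : hybrid_system (R * 'rV[R]_n) :=
  {| flow_set := Cset Q X V delta ;
     flow_map := closed_loop f kappa ;
     jump_set := Dset Q X V delta ;
     jump_map := fun x => Gc Q V x.2 `*` [set x.2] |}.

(* Main.v *)
(* The Lyapunov function V is nonincreasing along solutions: a state of C that
   is not in A lies outside the closure of X \ Y, hence in Y, where V decreases
   along flows, and a jump replaces V by V - mu <= V - delta.  Stability of A
   and boundedness follow from the compactness of the sublevel sets.  If V
   stayed above c > 0 along a solution, every jump would cost a fixed amount,
   so the solution would eventually flow forever in C; a limit of its time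
   translates is a solution on the whole real line along which V is a positive
   constant, so its range is weakly invariant and lies in Psi \ A, where
   mu > delta, contradicting mu <= delta on C.  When the gap totally exceeds
   delta, B and C meet only in A, so that a solution starting near B either
   starts near A or must jump at once, to a state where V is the minimum over
   the modes, which is small near B. *)
Require Import Defs.
From HB Require Import structures.
From mathcomp Require Import all_boot all_order all_algebra finmap.
From mathcomp Require Import all_classical all_reals all_analysis.
From mathcomp Require Import ring lra.

Set Implicit Arguments.
Unset Strict Implicit.
Unset Printing Implicit Defensive.

Import Order.TTheory GRing.Theory Num.Theory.
Import numFieldNormedType.Exports.

Local Open Scope classical_set_scope.
Local Open Scope ring_scope.

(** * Absolutely continuous solutions *)

(** Real induction: at the supremum of the points where [P] holds, [step] carries [P] from an
    adherent point on the left to a point beyond the supremum, unless [b] comes first. *)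
Lemma real_interval_ind (R : realType) (a b : R) (P : R -> Prop) :
  a <= b -> P a ->
  (forall s, a <= s <= b -> exists2 r : R, 0 < r & forall v w,
     a <= v -> s - r < v -> v <= s -> s <= w -> w < s + r -> w <= b ->
     P v -> P w) ->
  P b.
Proof.
move=> ab Pa step.
pose S := [set v | a <= v <= b /\ P v].
have Sa : S a by rewrite /S/= lexx ab.
have supS : has_sup S by split; [exists a | exists b => v [/andP[]]].
have sab : a <= sup S <= b.
  rewrite sup_upper_bound//=; apply: ge_sup; first by exists a.
  by move=> v [/andP[]].
have [r r0 Pr] := step _ sab.
have [v [/andP[av vb] Pv] sv] := sup_adherent r0 supS.
have vs : v <= sup S by apply: sup_upper_bound => //; rewrite /S/= av vb.
case/andP: sab => as_ sb.
have r20 : 0 < r / 2 by rewrite divr_gt0.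
have [bs|sb'] := leP b (sup S + r / 2); first by apply: (Pr v) => //; lra.
have Pw : P (sup S + r / 2) by apply: (Pr v) => //; lra.
have : sup S + r / 2 <= sup S; last lra.
by apply: sup_upper_bound => //; split => //; lra.
Qed.

Lemma negligible_small_open (R : realType) (N : set R) (e : R) :
  (@lebesgue_measure R).-negligible N -> 0 < e ->
  exists U : set R, [/\ open U, N `<=` U & (lebesgue_measure U <= e%:E)%E].
Proof.
move=> /negligible_outer_measure N0 e0.
have [U [oU NU]] := @outer_measure_open_le R N e e0.
by rewrite N0 add0e => Ue; exists U.
Qed.

Lemma sum_itv_le_measure (R : realType) (U : set R) (N : nat)
    (s t : nat -> R) :
  measurable U -> (forall i, (i < N)%N -> s i <= t i) ->
  (forall i, (i < N)%N -> `]s i, t i[%classic `<=` U) ->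
  trivIset `I_N (fun i => `]s i, t i[%classic) ->
  ((\sum_(i < N) (t i - s i))%:E <= lebesgue_measure U)%E.
Proof.
move=> mU st sU tI.
pose F i : set R := `]s i, t i[%classic.
have mF k : measurable (F k) by exact: measurable_itv.
have mB : measurable (\big[setU/set0]_(k < N) F k).
  by apply: bigsetU_measurable.
have E := measure_semi_additive_ord_I (@lebesgue_measure R) (fun k _ => mF k)
  tI mB.
 have : (lebesgue_measure (\big[setU/set0]_(k < N) F k) <=
    lebesgue_measure U)%E.
  apply: le_measure; rewrite ?inE//.
  by rewrite -bigcup_mkord => x [i /= iN]; exact: sU.
apply: le_trans; rewrite E -sumEFin; apply: lee_sum => i _.
apply: (@le_trans _ _ (lebesgue_measure (F i))); last exact: lexx.
rewrite /F lebesgue_measure_itv/= lte_fin.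
by case: ltP => // h; rewrite lee_fin subr_le0.
Qed.

(** Free of quotients, this form admits [s = t] and combines directly with the triangle
    inequality. *)
Lemma is_derive1P (R : realType) (W : normedModType R) (x : R -> W) (t : R)
    (v : W) :
  is_derive t 1 x v <-> forall e : R, 0 < e -> exists2 r : R, 0 < r &
    forall s, `|s - t| < r -> `|x s - x t - (s - t) *: v| <= e * `|s - t|.
Proof.
split=> [[dx xv] e e0|h].
  have : h^-1 *: ((x \o shift t) (h *: 1) - x t) @[h --> 0^'] --> v.
    by rewrite -xv; exact: dx.
  move=> /cvgrPdist_le /(_ e e0); rewrite near_withinE near_simpl.
  move=> /nbhs_ballP[r /= r0 rP]; exists r => // s st.
  have [->|sNt] := eqVneq s t; first by rewrite !subrr scale0r subr0 !normr0 mulr0.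
  have st0 : s - t != 0 by rewrite subr_eq0.
  have := rP (s - t); rewrite /ball/= sub0r normrN => /(_ st st0).
  rewrite scaler1 subrK => le.
  have -> : x s - x t - (s - t) *: v = (s - t) *: ((s - t)^-1 *: (x s - x t) - v).
    by rewrite scalerBr scalerA mulfV// scale1r.
  by rewrite normrZ mulrC ler_wpM2r// distrC.
have cv : h^-1 *: ((x \o shift t) (h *: 1) - x t) @[h --> 0^'] --> v.
  apply/cvgrPdist_le => e e0; have [r r0 rP] := h e e0.
  rewrite near_withinE near_simpl; apply/nbhs_ballP; exists r => //= s.
  rewrite /ball/= sub0r normrN => sr s0.
  have := rP (s + t); rewrite addrK => /(_ sr) le; rewrite scaler1.
  have -> : v - s^-1 *: (x (s + t) - x t) =
      - (s^-1 *: (x (s + t) - x t - s *: v)).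
    by rewrite [s^-1 *: (_ - s *: v)]scalerBr scalerA mulVf// scale1r opprB.
  by rewrite normrN normrZ normfV ler_pdivrMl ?normr_gt0// mulrC.
split; first by apply/cvg_ex; exists v.
exact: cvg_lim cv.
Qed.

Lemma affine_defectD (R : realType) (W : normedModType R) (x : R -> W) (c : W)
    (u v w : R) :
  x w - x u - (w - u) *: c =
  (x v - x u - (v - u) *: c) + (x w - x v - (w - v) *: c).
Proof.
rewrite addrACA -opprD -scalerDl.
by congr (_ - _ *: c); rewrite [RHS]addrC addrA subrK.
Qed.

(** A mean value inequality that avoids integrating [W]-valued functions. Real induction propagates
    the bound: a first-order expansion serves where the derivative exists; elsewhere the increment
    is stored in a finite family of intervals. *)
Lemma abs_continuous_ae_derive_le (R : realType) (W : normedModType R)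
    (a b K : R) (x g : R -> W) (c : W) :
  a <= b -> abs_continuous a b x ->
  {ae @lebesgue_measure R, forall t, a <= t <= b -> is_derive t 1 x (g t)} ->
  (forall t, a <= t <= b -> `|g t - c| <= K) ->
  `|x b - x a - (b - a) *: c| <= K * (b - a).
Proof.
move=> ab acx aex gK; apply/ler_addgt0Pr => e0 e0_gt0.
(* The denominator collects the coefficients of [e] in the final bound: [b - a] from the points of
   differentiability, [1] from the increments of [x] over the stored intervals, the norm of [c] from
   their total length. *)
pose e := e0 / (b - a + 1 + `|c|).
have den : 0 < b - a + 1 + `|c| by rewrite ltr_wpDr// ltr_wpDl// subr_ge0.
have e_gt0 : 0 < e by rewrite divr_gt0.
have [d d0 dP] := acx e e_gt0.
(* [d / 2] keeps the total length strictly below [d]; [e] controls the term in [c]. *)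
have de0 : 0 < Num.min (d / 2) e by rewrite lt_min e_gt0 divr_gt0.
have [U [oU NU Ud]] := negligible_small_open aex de0.
(* Where the derivative is missing, the increments of x over disjoint intervals
   inside a small open set U are controlled by absolute continuity. *)
pose P v := exists (N : nat) (s t : nat -> R),
  [/\ forall i, (i < N)%N -> [/\ a <= s i, s i <= t i & t i <= v],
      forall i, (i < N)%N -> `]s i, t i[%classic `<=` U,
      forall i j, (i < j < N)%N -> t i <= s j &
      `|x v - x a - (v - a) *: c| <= (K + e) * (v - a) +
        \sum_(i < N) `|x (t i) - x (s i)| + `|c| * \sum_(i < N) (t i - s i)].
have Pb : P b.
  apply: (real_interval_ind ab).
    exists 0%N, (fun=> 0), (fun=> 0); split => //.
    by rewrite !big_ord0 !subrr scale0r subr0 normr0 !mulr0 !addr0.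
  move=> u uab; have [Uu|nUu] := pselect (U u).
    have /nbhs_ballP[r /= r0 rU] : nbhs u U by exact: open_nbhs_nbhs.
    (* Near a point of [U], the interval from [v] to [w] joins the family as its last member, of
       index [N]. *)
    exists r => // v w av uv vu uw wu wb [N [s [t [stv stU sto Pv]]]].
    pose s' i := if i == N then v else s i.
    pose t' i := if i == N then w else t i.
    have vw : v <= w by exact: le_trans uw.
    exists N.+1, s', t'; split.
    - move=> i; rewrite ltnS leq_eqVlt /s' /t'; have [//|_/=] := eqVneq i N.
      by move=> /stv[asi sti tiv]; split => //; exact: le_trans vw.
    - move=> i; rewrite ltnS leq_eqVlt /s' /t'.
      have [/= _ _|_/=] := eqVneq i N; last exact: stU.
      move=> z /=; rewrite in_itv/= => /andP[vz zw]; apply: rU.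
      by rewrite /ball/= ltr_norml; apply/andP; split; lra.
    - move=> i j; rewrite ltnS /s' /t' => /andP[ij jN].
      have iN : (i < N)%N by exact: leq_trans jN.
      rewrite (ltn_eqF iN); have [_|jNN] := eqVneq j N.
        by have [] := stv _ iN.
      by apply: sto; rewrite ij ltn_neqAle jNN.
    - rewrite !big_ord_recr/= /s' /t' eqxx.
      under eq_bigr => i _ do rewrite (ltn_eqF (ltn_ord i)).
      under [X in _ <= _ + _ * (X + _)]eq_bigr => i _ do
        rewrite (ltn_eqF (ltn_ord i)).
      rewrite (affine_defectD x c a v w); apply: (le_trans (ler_normD _ _)).
      have : `|x w - x v - (w - v) *: c| <= `|x w - x v| + `|c| * (w - v).
        rewrite (le_trans (ler_normB _ _))// normrZ ger0_norm ?subr_ge0//.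
        by rewrite mulrC.
      have K0 : 0 <= K + e.
        by rewrite addr_ge0 ?(ltW e_gt0)// (le_trans _ (gK _ uab)).
      have : (K + e) * (v - a) <= (K + e) * (w - a).
        by rewrite ler_wpM2l// lerB.
      by rewrite mulrDr; lra.
  (* Outside [U] the derivative exists, and the family is left unchanged. *)
  have dxu : a <= u <= b -> is_derive u 1 x (g u).
    by apply: contrapT => h; apply: nUu; apply: NU.
  have [r r0 rP] := (is_derive1P _ _ _).1 (dxu uab) e e_gt0.
  exists r => // v w av uv vu uw wu wb [N [s [t [stv stU sto Pv]]]].
  exists N, s, t; split => //.
    move=> i /stv[asi sti tiv]; split => //.
    exact: le_trans tiv (le_trans vu uw).
  rewrite (affine_defectD x c a v w); apply: (le_trans (ler_normD _ _)).
  have vw : v <= w by exact: le_trans uw.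
  have := rP w; rewrite ger0_norm ?subr_ge0// => xw_.
  have {xw_}xw := xw_ ltac:(lra).
  have := rP v; rewrite ler0_norm ?subr_le0// => xv_.
  have {xv_}xv := xv_ ltac:(lra).
  (* Both expansions are based at [u], which lies between [v] and [w], so their errors add up to
     [e * (w - v)]. *)
  have -> : x w - x v - (w - v) *: c =
      (x w - x u - (w - u) *: g u) - (x v - x u - (v - u) *: g u) +
      (w - v) *: (g u - c).
    by rewrite (affine_defectD x (g u) u v w) [X in _ = X + _]addrC addKr
      scalerBr subrKA.
  have : `|(w - v) *: (g u - c)| <= K * (w - v).
    by rewrite normrZ ger0_norm ?subr_ge0// mulrC ler_wpM2r ?subr_ge0// gK.
  have := ler_normB (x w - x u - (w - u) *: g u) (x v - x u - (v - u) *: g u).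
  have := ler_normD (x w - x u - (w - u) *: g u - (x v - x u - (v - u) *: g u))
    ((w - v) *: (g u - c)).
  by lra.
case: Pb => N [s [t [stv stU sto Pb]]].
have tI : trivIset `I_N (fun i => `]s i, t i[%classic).
  move=> i j /= iN jN [z /=[]]; rewrite !in_itv/= => /andP[zi zi'] /andP[zj zj'].
  have [ij|ji|//] := ltngtP i j.
    by have := sto i j; rewrite ij jN leNgt (lt_trans zj zi') => /(_ isT).
  by have := sto j i; rewrite ji iN leNgt (lt_trans zi zj') => /(_ isT).
have sumU : \sum_(i < N) (t i - s i) <= Num.min (d / 2) e.
  rewrite -lee_fin; apply: le_trans Ud; apply: sum_itv_le_measure => //.
    exact: measurable_realfun.open_measurable.
  by move=> i /stv[].
have /andP[sumd sume] : (\sum_(i < N) (t i - s i) <= d / 2) &&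
    (\sum_(i < N) (t i - s i) <= e) by rewrite -le_min.
have xe := dP N s t stv tI.
have {}xe : \sum_(i < N) `|x (t i) - x (s i)| < e by apply: xe; lra.
apply: (le_trans Pb); have ce : `|c| * \sum_(i < N) (t i - s i) <= `|c| * e.
  by rewrite ler_wpM2l.
have : e0 = e * (b - a + 1 + `|c|) by rewrite /e divfK// gt_eqF.
by move=> ->; nra.
Qed.

Lemma near_normP (R : realType) (W : normedModType R) (x : W) (P : W -> Prop) :
  (\forall y \near x, P y) <->
  exists2 r : R, 0 < r & forall y, `|y - x| < r -> P y.
Proof.
split=> [/nbhs_normP[r /= r0 rP]|[r r0 rP]].
  by exists r => // y yx; apply: rP; rewrite /= distrC.
by apply/nbhs_normP; exists r => //= y; rewrite /= distrC; exact: rP.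
Qed.

Lemma within_continuousP (R : realType) (W W' : normedModType R) (X : set W)
    (F : W -> W') :
  {within X, continuous F} <-> forall x, X x -> forall e : R, 0 < e ->
    \forall y \near x, X y -> `|F y - F x| < e.
Proof.
split=> [/subspace_continuousP cF x Xx e e0|cF].
  have /cvgrPdist_lt/(_ e e0) := cF x Xx.
  by rewrite near_withinE; apply: filterS => y + Xy => /(_ Xy); rewrite distrC.
apply/subspace_continuousP => x Xx; apply/cvgrPdist_lt => e e0.
rewrite near_withinE; have := cF x Xx e e0.
by apply: filterS => y + Xy => /(_ Xy); rewrite distrC.
Qed.

Section AbsContinuous.
Context (R : realType) (W : normedModType R).
Implicit Types (x : R -> W) (a b : R).

Lemma abs_continuous_unif a b x : abs_continuous a b x -> forall e : R, 0 < e ->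
  exists2 d : R, 0 < d & forall s t, a <= s <= b -> a <= t <= b ->
    `|t - s| < d -> `|x t - x s| < e.
Proof.
move=> acx e e0; have [d d0 dP] := acx e e0; exists d => // s t.
wlog st : s t / s <= t => [hw sab tab|/andP[as_ sb] /andP[at_ tb] tsd].
  have [st|/ltW st] := leP s t; first exact: hw.
  by rewrite distrC => sd; rewrite distrC; exact: hw.
have := dP 1%N (fun=> s) (fun=> t); rewrite !big_ord1; apply.
- by [].
- by move=> i j /=; rewrite !ltnS !leqn0 => /eqP-> /eqP->.
- by move: tsd; rewrite ger0_norm// subr_ge0.
Qed.

Lemma abs_continuous_within a b x :
  abs_continuous a b x -> {within `[a, b], continuous x}.
Proof.
move=> acx; apply/within_continuousP => t; rewrite /= in_itv/= => tab e e0.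
have [d d0 dP] := abs_continuous_unif acx e0.
by apply/near_normP; exists d => // s st; rewrite /= in_itv/= => sab; exact: dP.
Qed.

Lemma abs_continuous_sub a b c d x : a <= c -> d <= b ->
  abs_continuous a b x -> abs_continuous c d x.
Proof.
move=> ac db acx e e0; have [r r0 rP] := acx e e0; exists r => // N s t st.
apply: rP => i /st[cs st' td]; split => //.
- exact: le_trans cs.
- exact: le_trans db.
Qed.

Lemma lipschitz_abs_continuous a b (L : R) x :
  (forall s t, a <= s -> s <= t -> t <= b -> `|x t - x s| <= L * (t - s)) ->
  abs_continuous a b x.
Proof.
move=> Lx e e0; exists (e / (`|L| + 1)) => [|N s t st _ sd].
  by rewrite divr_gt0// ltr_wpDl.
have : (`|L| + 1) * \sum_(i < N) (t i - s i) < e.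
  by rewrite mulrC -ltr_pdivlMr// ltr_wpDl.
apply: le_lt_trans; rewrite mulr_sumr; apply: ler_sum => i _.
have [as_ sti tb] := st _ (ltn_ord i).
apply: (le_trans (Lx _ _ as_ sti tb)).
by rewrite ler_wpM2r ?subr_ge0// (le_trans (ler_norm _))// lerDl.
Qed.

Lemma abs_continuous_comp (W' : normedModType R) (h : W -> W') a b x :
  (forall u v, `|h u - h v| <= `|u - v|) ->
  abs_continuous a b x -> abs_continuous a b (h \o x).
Proof.
move=> hL acx e e0; have [d d0 dP] := acx e e0; exists d => // N s t st tI sd.
by apply: le_lt_trans (dP N s t st tI sd); apply: ler_sum => i _; exact: hL.
Qed.

End AbsContinuous.

Lemma ae_itv (R : realType) (P : R -> Prop) (I J : set R) :
  I `<=` J -> {ae @lebesgue_measure R, forall t, J t -> P t} ->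
  {ae @lebesgue_measure R, forall t, I t -> P t}.
Proof.
move=> IJ [N [mN N0 sN]]; exists N; split => // t /= nI.
by apply: sN => JP; apply: nI => /IJ.
Qed.

Lemma abs_continuous_ae_derive_dist (R : realType) (W : normedModType R)
    (a b K : R) (x g : R -> W) (c : W) (s u : R) :
  abs_continuous a b x ->
  {ae @lebesgue_measure R, forall t, a <= t <= b -> is_derive t 1 x (g t)} ->
  (forall t, a <= t <= b -> `|g t - c| <= K) ->
  a <= s <= b -> a <= u <= b ->
  `|x u - x s - (u - s) *: c| <= K * `|u - s|.
Proof.
move=> acx aex gK; wlog su : s u / s <= u.
  move=> hw sab uab; have [su|/ltW us] := leP s u; first exact: hw.
  have -> : x u - x s - (u - s) *: c = - (x s - x u - (s - u) *: c).
    by rewrite -[s - u]opprB scaleNr opprK opprD opprB.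
  by rewrite normrN [X in _ * X]distrC; exact: hw.
move=> /andP[as_ sb] /andP[au ub]; rewrite ger0_norm ?subr_ge0//.
have sub v : s <= v <= u -> a <= v <= b.
  by move=> /andP[sv vu]; rewrite (le_trans as_ sv) (le_trans vu ub).
apply: abs_continuous_ae_derive_le => //.
- exact: abs_continuous_sub acx.
- by apply: ae_itv aex => v; exact: sub.
- by move=> v /sub; exact: gK.
Qed.

(** A continuous field makes an almost-everywhere solution classical at interior times: near [t],
    [F \o x] is within [e] of [F (x t)], and the mean value inequality with the constant [F (x t)]
    is the required expansion. *)
Lemma ae_solution_derive (R : realType) (W : normedModType R) (X : set W)
    (F : W -> W) (a b : R) (x : R -> W) :
  {within X, continuous F} -> abs_continuous a b x ->
  (forall t, a <= t <= b -> X (x t)) ->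
  {ae @lebesgue_measure R, forall t, a <= t <= b -> is_derive t 1 x (F (x t))} ->
  forall t, a < t < b -> is_derive t 1 x (F (x t)).
Proof.
move=> /within_continuousP cF acx Xx aex t /andP[at_ tb].
have tab : a <= t <= b by rewrite !ltW.
apply/is_derive1P => e e0.
have /near_normP[r r0 rP] := cF _ (Xx _ tab) e e0.
have [d d0 dP] := abs_continuous_unif acx r0.
pose m := Num.min (d / 2) (Num.min (t - a) (b - t)).
have m0 : 0 < m by rewrite !lt_min !subr_gt0 divr_gt0// at_ tb.
have [md ma mb] : [/\ m <= d / 2, m <= t - a & m <= b - t].
  by rewrite /m !ge_min !lexx !orbT.
have sub v : t - m <= v <= t + m -> a <= v <= b by lra.
exists m => // s; rewrite ltr_norml => /andP[ms sm].
apply: (@abs_continuous_ae_derive_dist _ _ (t - m) (t + m) e x (F \o x)).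
- by apply: abs_continuous_sub acx; lra.
- by apply: ae_itv aex => v; exact: sub.
- move=> v vm; apply/ltW/rP; last exact/Xx/sub.
  by apply: dP => //; [exact: sub|rewrite ltr_norml; lra].
- by lra.
- by lra.
Qed.

Lemma subr_perturb (V : zmodType) (u v u' v' c : V) :
  u' - v' - c = (u - v - c) - (u - u') + (v - v').
Proof.
rewrite opprB -[u - v - c]addrA [_ + (u' - u)]addrC subrKA.
by rewrite -[RHS]addrA [- v - c]addrC subrKA addrA addrAC.
Qed.

Lemma within_continuous_comp (R : realType) (W1 W2 W3 : normedModType R)
    (S : set W1) (X : set W2) (x : W1 -> W2) (F : W2 -> W3) :
  {within S, continuous x} -> {within X, continuous F} ->
  (forall t, S t -> X (x t)) -> {within S, continuous (F \o x)}.
Proof.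
move=> /within_continuousP cx /within_continuousP cF SX.
apply/within_continuousP => t St e e0.
have /near_normP[r r0 rP] := cF _ (SX _ St) e e0.
have := cx t St r r0; apply: filterS => s xs Ss; apply: rP; last exact: SX.
exact: xs.
Qed.

(** * Limits of translates of a solution staying in a compact set *)

Lemma compact_norm_le (R : realType) (W : normedModType R) (K : set W) :
  compact K -> exists2 M : R, 0 <= M & forall x, K x -> `|x| <= M.
Proof.
move=> /compact_bounded[M [_ MP]]; exists (`|M| + 1); first by rewrite addr_ge0.
move=> x Kx; apply: (MP (`|M| + 1)) => //.
by rewrite (le_lt_trans (ler_norm _))// ltrDl.
Qed.

Lemma ultra_fmap (T U : Type) (f : T -> U) (G : set_system T) :
  UltraFilter G -> UltraFilter (f @ G).
Proof.
move=> uG; split; first exact: fmap_proper_filter.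
move=> H pH GH; rewrite eqEsubset; split => // A HA.
have [//|GA] := in_ultra_setVsetC (f @^-1` A) uG.
have HC : H (~` A) by exact: GH.
by have [? []] := filter_ex (filterI HA HC).
Qed.

(* The limit of the translates x(t + .) is taken along a single ultrafilter at
   +oo, for every s at once: equi-Lipschitz continuity makes the limit a
   solution, so that no diagonal extraction is needed. *)
Lemma ode_limit_solution (R : realType) (W : normedModType R) (X K : set W)
    (F : W -> W) (a : R) (x : R -> W) :
  {within X, continuous F} -> compact K -> K `<=` X ->
  (forall b, abs_continuous a b x) ->
  {ae @lebesgue_measure R, forall t, a <= t -> is_derive t 1 x (F (x t))} ->
  (forall t, a <= t -> K (x t)) ->
  exists y : R -> W, [/\ forall s, K (y s),
    forall s : R, is_derive s 1 y (F (y s)),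
    exists L, forall s t, s <= t -> `|y t - y s| <= L * (t - s) &
    forall s (e N : R), 0 < e -> exists2 t, N <= t & `|x t - y s| < e].
Proof.
move=> cF cK KX acx aex Kx.
have [L L0 FL] : exists2 L, 0 <= L & forall z, K z -> `|F z| <= L.
  have cKF : compact (F @` K).
    by apply: continuous_compact => //; exact: continuous_subspaceW cF.
  have [L L0 LP] := compact_norm_le cKF.
  by exists L => // z Kz; apply: LP; exists z.
move/within_continuousP : cF => cF.
have aexb c b : a <= c -> {ae @lebesgue_measure R, forall t, c <= t <= b ->
    is_derive t 1 x (F (x t))}.
  by move=> ac; apply: ae_itv aex => t /= /andP[ct _]; exact: le_trans ct.
have Lx s t : a <= s -> a <= t -> `|x t - x s| <= L * `|t - s|.
  move=> as_ at_; have := @abs_continuous_ae_derive_dist _ _ a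
    (Num.max s t) L x (F \o x) 0 s t (acx _) (aexb _ _ (lexx _)).
  rewrite scaler0 subr0; apply.
  - by move=> u /andP[au _]; rewrite subr0; exact/FL/Kx.
  - by rewrite as_ le_max lexx.
  - by rewrite at_ le_max lexx orbT.
have [U [uU Uoo]] := ultraFilterLemma (@proper_pinfty_nbhs R).
have Uge N : U [set t | N <= t] by 
  apply: Uoo; apply: nbhs_pinfty_ge; exact: num_real.
have UgeD N s : U [set t | N <= t + s].
  by apply: filterS (Uge (N - s)) => t /=; rewrite lerBlDr.
have /choice[y yP] s : exists p, K p /\ x (t + s) @[t --> U] --> p.
  have uxU : UltraFilter (x (t + s) @[t --> U]).
    exact: (@ultra_fmap _ _ (fun t => x (t + s)) U uU).
  have UK : U [set t | K (x (t + s))].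
    by apply: filterS (UgeD a s) => t; exact: Kx.
  have := cK; rewrite compact_ultra => /(_ _ uxU UK)[p [Kp xp]].
  by exists p.
have xy s e : 0 < e -> U [set t | `|x (t + s) - y s| < e].
  move=> e0; have [_ /cvgrPdist_lt/(_ e e0)] := yP s.
  by apply: filterS => t; rewrite distrC.
have Ky s : K (y s) by have [] := yP s.
exists y; split => //.
- move=> s; apply/is_derive1P => e e0.
  have /near_normP[r r0 rP] := cF _ (KX _ (Ky s)) e e0.
  (* Within time [h] of [t + s], [x] moves by at most [L * h <= r / 2]; as [x (t + s)] will be
     within [r / 2] of [y s], [x] stays where [F] is [e]-close to [F (y s)]. *)
  pose h := r / (2 * (L + 1)).
  have L10 : 0 < L + 1 by rewrite ltr_wpDl.
  have h0 : 0 < h by rewrite divr_gt0// mulr_gt0.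
  have Lh : L * h <= r / 2.
    have -> : r / 2 = (L + 1) * h by rewrite /h; field; rewrite gt_eqF.
    by rewrite ler_wpM2r ?lerDl// ltW.
  exists h => // u us; apply/ler_addgt0Pr => e' e'0.
  have e20 : 0 < e' / 2 by rewrite divr_gt0.
  have r20 : 0 < r / 2 by rewrite divr_gt0.
  (* One [t] serves both [s] and [u]; each of the two approximations costs [e' / 2], with [e']
     arbitrary. *)
  have [t [[/= ts tu] [tr ta]]] := filter_ex (filterI (filterI (xy s _ e20)
    (xy u _ e20)) (filterI (xy s _ r20) (UgeD (a + h) s))).
  have main : `|x (t + u) - x (t + s) - (u - s) *: F (y s)| <= e * `|u - s|.
    have -> : u - s = (t + u) - (t + s) by rewrite opprD addrACA subrr add0r.
    move: us; rewrite ltr_norml => /andP[us su].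
    apply: (@abs_continuous_ae_derive_dist _ _ (t + s - h) (t + s + h) e x
      (F \o x)).
    + by apply: abs_continuous_sub (acx (t + s + h)) => //; move: ta => /=; lra.
    + by apply: aexb; move: ta => /=; lra.
    + move=> v /andP[v1 v2]; have av : a <= v by move: ta => /=; lra.
      apply/ltW/rP; last exact/KX/Kx.
      rewrite -(subrK (x (t + s)) (x v)) -addrA.
      apply: (le_lt_trans (ler_normD _ _)).
      have vs : `|x v - x (t + s)| <= L * h.
        apply: le_trans (Lx (t + s) v _ _) _ => //; first by move: ta => /=; lra.
        by rewrite ler_wpM2l// ler_norml; apply/andP; split; lra.
      by move: tr => /=; lra.
    + by lra.
    + by lra.
  have -> : y u - y s - (u - s) *: F (y s) =
      (x (t + u) - x (t + s) - (u - s) *: F (y s)) -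
      (x (t + u) - y u) + (x (t + s) - y s).
    exact: subr_perturb.
  have := ler_normD (x (t + u) - x (t + s) - (u - s) *: F (y s) -
      (x (t + u) - y u)) (x (t + s) - y s).
  have := ler_normB (x (t + u) - x (t + s) - (u - s) *: F (y s))
      (x (t + u) - y u).
  by lra.
- exists L => s u su; apply/ler_addgt0Pr => e e0.
  have e20 : 0 < e / 2 by rewrite divr_gt0.
  have [t [[/= ts tu] [tas tau]]] := filter_ex (filterI (filterI (xy s _ e20)
    (xy u _ e20)) (filterI (UgeD a s) (UgeD a u))).
  have := Lx _ _ tas tau; rewrite opprD addrACA subrr add0r.
  rewrite (ger0_norm (_ : 0 <= u - s)) ?subr_ge0// => xus.
  have -> : y u - y s = (x (t + u) - x (t + s)) - (x (t + u) - y u) +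
      (x (t + s) - y s).
    by have := subr_perturb (x (t + u)) (x (t + s)) (y u) (y s) 0; rewrite !subr0.
  have := ler_normD (x (t + u) - x (t + s) - (x (t + u) - y u))
    (x (t + s) - y s).
  have := ler_normB (x (t + u) - x (t + s)) (x (t + u) - y u).
  by lra.
- move=> s e N e0.
  have [t [tN ts]] := filter_ex (filterI (UgeD N s) (xy s e e0)).
  by exists (t + s).
Qed.

(** * Distance to a set and uniformity over compact sets *)

Lemma edist_inf_ltP (R : realType) (W : normedModType R) (K : set W) (x : W)
    (d : R) :
  (edist_inf K x < d%:E)%E <-> exists2 k, K k & `|x - k| < d.
Proof.
split=> [/ereal_inf_lt[_ [k Kk <-]] /edist_lt_ball /=|[k Kk xk]].
  by rewrite -ball_normE => xk; exists k.
pose r := (`|x - k| + d) / 2.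
have [xr rd] : `|x - k| < r /\ r < d by rewrite /r; lra.
apply: (@le_lt_trans _ _ r%:E); last by rewrite lte_fin.
apply: (@le_trans _ _ (edist (x, k))); first by apply: ereal_inf_lbound; exists k.
apply: ereal_inf_lbound; exists r => //; split.
  by rewrite /= (le_lt_trans _ xr).
by rewrite /= -ball_normE.
Qed.

(** Each point brings its own threshold, valid nearby; the near-covering form of compactness, with
    [d] tending to [0] from the right, replaces the extraction of a finite subcover. *)
Lemma compact_near_pos (R : realType) (W : normedModType R) (K : set W)
    (P : R -> W -> Prop) :
  compact K ->
  (forall k, K k -> exists2 r : R, 0 < r &
     \forall x \near k, forall d, 0 < d < r -> P d x) ->
  exists2 d : R, 0 < d & forall k, K k -> P d k.
Proof.
move=> /compact_near_coveringP cK KP.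
have : \forall d \near 0^'+, K `<=` (fun k => 0 < d -> P d k).
  apply: cK => k Kk; have [r r0 rP] := KP k Kk.
  exists ([set k' | forall d, 0 < d < r -> P d k'], [set d | d < r]).
    by split => //=; exact: nbhs_right_lt.
  by move=> [k' d] /= [k'P dr] d0; apply: k'P; rewrite d0.
move=> /(filterI (nbhs_right_gt 0)) /filter_ex[d [/= d0 dP]].
by exists d => // k Kk; exact: dP.
Qed.

Lemma compact_near_edist (R : realType) (W : normedModType R) (K : set W)
    (P : W -> Prop) :
  compact K -> (forall k, K k -> \forall x \near k, P x) ->
  exists2 d : R, 0 < d & forall x, (edist_inf K x <= d%:E)%E -> P x.
Proof.
move=> cK KP.
have [d d0 dP] : exists2 d : R, 0 < d &
    forall k, K k -> forall x, `|x - k| < d -> P x.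
  apply: compact_near_pos => // k Kk.
  have /near_normP[r r0 rP] := KP k Kk.
  have r20 : 0 < r / 2 by rewrite divr_gt0.
  (* Half of the radius is spent on moving the centre, the other half remains for the ball around
     [k']. *)
  exists (r / 2) => //; apply/near_normP; exists (r / 2) => // k' k'k d.
  move=> /andP[d0 dr] x xk'; apply: rP.
  have := ler_normD (x - k') (k' - k); rewrite addrA subrK; lra.
exists (d / 2); first by rewrite divr_gt0.
move=> x xd; have /edist_inf_ltP[k Kk xk] : (edist_inf K x < d%:E)%E.
  by apply: le_lt_trans xd _; rewrite lte_fin; lra.
exact: dP xk.
Qed.

(** Modes are isolated, so the states of [X] close to a given one share its mode. *)
Lemma seq_isolated (R : realType) (l : seq R) (q : R) :
  exists2 r : R, 0 < r & forall s, s \in l -> `|s - q| < r -> s = q.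
Proof.
elim: l => [|u l [r r0 rP]]; first by exists 1.
have [->|uq] := eqVneq u q.
  by exists r => // s; rewrite inE => /orP[/eqP->//|]; exact: rP.
exists (Num.min r `|u - q|).
  by rewrite lt_min r0 normr_gt0 subr_eq0.
move=> s; rewrite inE lt_min => /orP[/eqP->|sl] /andP[sr su]; last exact: rP.
by rewrite ltxx in su.
Qed.

(** * Derivatives along curves in the product of modes and continuous states *)

Lemma norm_fst_le (R : realType) (W W' : normedModType R) (p : W * W') :
  `|p.1| <= `|p|.
Proof. by rewrite prod_normE le_max lexx. Qed.

Lemma norm_snd_le (R : realType) (W W' : normedModType R) (p : W * W') :
  `|p.2| <= `|p|.
Proof. by rewrite prod_normE le_max lexx orbT. Qed.

Lemma is_derive1_fst (R : realType) (W W' : normedModType R)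
    (x : R -> W * W') (t : R) (v : W * W') :
  is_derive t 1 x v -> is_derive t 1 (fst \o x) v.1.
Proof.
move=> /is_derive1P dx; apply/is_derive1P => e e0.
have [r r0 rP] := dx e e0; exists r => // s st.
exact: le_trans (norm_fst_le _) (rP s st).
Qed.

Lemma is_derive1_snd (R : realType) (W W' : normedModType R)
    (x : R -> W * W') (t : R) (v : W * W') :
  is_derive t 1 x v -> is_derive t 1 (snd \o x) v.2.
Proof.
move=> /is_derive1P dx; apply/is_derive1P => e e0.
have [r r0 rP] := dx e e0; exists r => // s st.
exact: le_trans (norm_snd_le _) (rP s st).
Qed.

(** [grad_z] records partial derivatives only; differentiability makes the directional derivative
    linear, hence determined on the basis vectors. *)
Lemma derive_grad (R : realType) (n : nat) (V : R * 'rV[R]_n -> R)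
    (p : R * 'rV[R]_n) (w : 'rV[R]_n) :
  differentiable (fun z => V (p.1, z)) p.2 ->
  'D_w (fun z => V (p.1, z)) p.2 = inner (grad_z V p) w.
Proof.
move=> dV; rewrite deriveE// [in LHS](row_sum_delta w) linear_sum.
apply: eq_bigr => i _; rewrite linearZ/= mxE deriveE//.
by rewrite mulrC.
Qed.

(** No regularity of [V] in the mode is available. With the mode locally constant, [V \o x] agrees
    near [t] with a function of [z] along the second component, to which the chain rule applies. *)
Lemma is_derive1_comp_grad (R : realType) (n : nat) (V : R * 'rV[R]_n -> R)
    (x : R -> R * 'rV[R]_n) (t : R) (w : R * 'rV[R]_n) :
  (\forall s \near t, (x s).1 = (x t).1) ->
  differentiable (fun z => V ((x t).1, z)) (x t).2 ->
  is_derive t 1 x w -> is_derive t 1 (V \o x) (inner (grad_z V (x t)) w.2).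
Proof.
move=> xt dV /is_derive1_snd [dx xw].
pose g z := V ((x t).1, z).
have dx' : differentiable (snd \o x) t by apply/derivable1_diffP.
apply: (@near_eq_is_derive _ _ _ (g \o (snd \o x))).
  by apply: filterS xt => s xs; rewrite /g /= -xs -surjective_pairing.
have dgx : differentiable (g \o (snd \o x)) t by exact: differentiable_comp.
apply: DeriveDef; first exact/derivable1_diffP.
by rewrite deriveE// diff_comp//= -[X in 'd g _ X]deriveE// xw -deriveE//
  derive_grad.
Qed.

(** * Minimum over the modes *)

Section MinOverModes.
Context (R : realType) (n : nat) (Q : {fset R}) (V : R * 'rV[R]_n -> R).

Definition min_modes (x : R * 'rV[R]_n) : R :=
  \big[Num.min/V x]_(s <- Q) V (s, x.2).

Lemma min_modes_le s x : s \in Q -> min_modes x <= V (s, x.2).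
Proof. by move=> sQ; apply: (@bigmin_inf_seq _ _ _ _ _ s). Qed.

Lemma min_modes_ex x : x.1 \in Q -> exists2 s, s \in Q & min_modes x = V (s, x.2).
Proof.
move=> xQ; rewrite /min_modes.
(* The seed [V x] is the value at mode [x.1]; adding this mode to the list makes the induction start
   at the empty list. *)
have : exists2 s, s \in x.1 :: Q & \big[Num.min/V x]_(s <- Q) V (s, x.2) = V (s, x.2).
  elim: (Q : seq R) => [|u l [s sl sE]].
    by exists x.1; rewrite ?mem_head// big_nil -surjective_pairing.
  rewrite big_cons sE /Num.min; case: ifP => _.
    by exists u => //; rewrite !inE eqxx orbT.
  by exists s => //; move: sl; rewrite !inE => /orP[->//|->]; rewrite !orbT.
by move=> [s]; rewrite inE => /orP[/eqP->|sQ] E; [exists x.1|exists s].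
Qed.

Lemma muE x : mu Q V x = V x - min_modes x. Proof. by []. Qed.

(** A finite minimum of continuous functions: [fiber_closed] keeps each [(s, x.2)] inside [X], where
    [V] is continuous. *)
Lemma within_continuous_min_modes (X : set (R * 'rV[R]_n)) :
  fiber_closed Q X -> {within X, continuous V} ->
  {within X, continuous min_modes}.
Proof.
move=> fX cV; rewrite /min_modes.
suff H (l : seq R) : {subset l <= Q} ->
  {within X, continuous (fun x => \big[Num.min/V x]_(s <- l) V (s, x.2))}.
  exact: H.
elim: l => [|u l IH] lQ.
  suff -> : (fun x => \big[Num.min/V x]_(s <- [::]) V (s, x.2)) = V by [].
  by apply/funext => x; rewrite big_nil.
have {}IH := IH (fun s sl => lQ s (@mem_behead _ (u :: l) s sl)).
have uQ : u \in Q by apply: lQ; exact: mem_head.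
have cVu : {within X, continuous (V \o (fun x => (u, x.2)))}.
  apply: (within_continuous_comp (X := X)) => //.
    apply/within_continuousP => x Xx e e0; apply/near_normP; exists e => // y yx _.
    rewrite prod_normE/= subrr normr0 gt_max e0/=.
    exact: le_lt_trans (norm_snd_le (y - x)) yx.
  by move=> [q z] Xq; exact: fX Xq uQ.
suff -> : (fun x => \big[Num.min/V x]_(s <- u :: l) V (s, x.2)) =
    (fun x => Num.min (V (u, x.2)) (\big[Num.min/V x]_(s <- l) V (s, x.2))).
  move=> x; apply: continuous_min; [exact: cVu|exact: IH].
by apply/funext => x; rewrite big_cons.
Qed.

End MinOverModes.

(** * Regularity and flows of the closed loop *)

(** Since modes are isolated, continuity in [z] at a fixed mode suffices. *)
Lemma C1_within_continuous (R : realType) (n : nat) (Q : {fset R})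
    (X : set (R * 'rV[R]_n)) (V : R * 'rV[R]_n -> R) :
  (forall x, X x -> x.1 \in Q) -> C1_on Q X V -> {within X, continuous V}.
Proof.
move=> XQ [U [oU XU dV _]]; apply/within_continuousP => -[q z] Xq e e0.
have qQ : q \in Q by exact: XQ Xq.
have /differentiable_continuous /cvgrPdist_lt/(_ e e0) : differentiable
    (fun z => V (q, z)) z.
  by apply: (dV (q, z)); split; [exact: XU|].
move=> /near_normP[r r0 rP]; have [r1 r10 r1P] := seq_isolated Q q.
apply/near_normP; exists (Num.min r r1); first by rewrite lt_min r0.
move=> [p w]; rewrite lt_min => /andP[pr pr1] Xp.
have pq : p = q.
  by apply: r1P; [exact: XQ Xp|exact: le_lt_trans (norm_fst_le _) pr1].
rewrite pq distrC; apply: rP; exact: le_lt_trans (norm_snd_le _) pr.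
Qed.

Lemma within_continuous_closed_loop (R : realType) (n m : nat)
    (X : set (R * 'rV[R]_n)) (f : (R * 'rV[R]_n) * 'rV[R]_m -> 'rV[R]_n)
    (kappa : R * 'rV[R]_n -> 'rV[R]_m) :
  {within X `*` [set: 'rV[R]_m], continuous f} -> {within X, continuous kappa} ->
  {within X, continuous (closed_loop f kappa)}.
Proof.
move=> cf ck.
have cfk : {within X, continuous (f \o (fun x => (x, kappa x)))}.
  apply: within_continuous_comp cf _ => //.
  apply/within_continuousP => x Xx e e0.
  have xe : \forall y \near x, `|y - x| < e by apply/near_normP; exists e.
  move/within_continuousP : ck => /(_ x Xx e e0); apply: filterS2 xe => y yx ky Xy.
  by rewrite prod_normE/= gt_max yx/= ky.
apply/within_continuousP => x Xx e e0.
move/within_continuousP : cfk => /(_ x Xx e e0); apply: filterS => y fy Xy.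
by rewrite prod_normE/= subrr normr0 gt_max e0/= fy.
Qed.

(** Hybrid solutions constrain flows only on the interior of their intervals; this recovers the end
    points. *)
Lemma closed_of_interior (R : realType) (W : normedModType R) (C : set W)
    (a b : R) (x : R -> W) :
  closed C -> a < b -> abs_continuous a b x ->
  (forall t, a < t < b -> C (x t)) -> forall t, a <= t <= b -> C (x t).
Proof.
move=> cC ab acx Cx t tab; apply: contrapT => nC.
have oC : open (~` C) by exact: closed_openC.
have : \forall y \near x t, (~` C) y by exact: open_nbhs_nbhs.
move=> /near_normP[r r0 rP].
have [d d0 dP] := abs_continuous_unif acx r0.
have [s [sab st]] : exists s, a < s < b /\ `|s - t| < d.
  (* The move goes towards the farther end, by less than [d] and at most a quarter of the length, so
     it lands in the interior. *)
  pose h := Num.min (d / 2) ((b - a) / 4).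
  have h0 : 0 < h by rewrite lt_min; lra.
  have hd : h <= d / 2 by rewrite ge_min lexx.
  have hab : h <= (b - a) / 4 by rewrite ge_min lexx orbT.
  have [tm|mt] := ltP t ((a + b) / 2).
    by exists (t + h); split; [lra|rewrite ltr_norml; lra].
  by exists (t - h); split; [lra|rewrite ltr_norml; lra].
have := rP (x s); apply; last exact: Cx.
by apply: dP => //; lra.
Qed.

Section ClosedLoopFlow.
Context (R : realType) (n m : nat).
Context (f : (R * 'rV[R]_n) * 'rV[R]_m -> 'rV[R]_n).
Context (kappa : R * 'rV[R]_n -> 'rV[R]_m) (x : R -> R * 'rV[R]_n) (a b : R).
Hypothesis acx : abs_continuous a b x.
Hypothesis aex : {ae @lebesgue_measure R, forall t, a <= t <= b ->
  is_derive t 1 x (closed_loop f kappa (x t))}.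

(** The mode has zero derivative almost everywhere, so the mean value inequality applies with
    [K = 0]. *)
Lemma closed_loop_mode_cst s u : a <= s <= b -> a <= u <= b ->
  (x u).1 = (x s).1.
Proof.
move=> sab uab.
have acx1 : abs_continuous a b (fst \o x).
  by apply: abs_continuous_comp acx => p q; exact: (norm_fst_le (p - q)).
have aex1 : {ae @lebesgue_measure R, forall t, a <= t <= b ->
    is_derive t 1 (fst \o x) 0}.
  case: aex => N [mN N0 sN]; exists N; split => // t /= h; apply: sN => h'.
  by apply: h => /h' /is_derive1_fst.
have : `|(x u).1 - (x s).1 - (u - s) *: 0| <= 0 * `|u - s|.
  apply: (@abs_continuous_ae_derive_dist _ _ a b 0 (fst \o x) (fun=> 0)) => //.
  by move=> t _; rewrite subr0 normr0.
by rewrite mul0r scaler0 subr0 normr_le0 subr_eq0 => /eqP.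
Qed.

(** Continuity of the field makes [V \o x] differentiable at every interior time, so the classical
    monotonicity criterion applies. *)
Lemma flow_nonincreasing (X : set (R * 'rV[R]_n)) (V : R * 'rV[R]_n -> R) :
  {within X, continuous (closed_loop f kappa)} -> {within X, continuous V} ->
  (forall y, X y -> differentiable (fun z => V (y.1, z)) y.2) ->
  (forall t, a <= t <= b -> X (x t)) ->
  (forall t, a < t < b -> Vdot f V kappa (x t) <= 0) ->
  a <= b -> V (x b) <= V (x a).
Proof.
move=> cF cV dV Xx Vx ab.
have dVx t : a < t < b -> is_derive t 1 (V \o x) (Vdot f V kappa (x t)).
  move=> tab; have tab' : a <= t <= b by lra.
  apply: (@is_derive1_comp_grad _ _ V x t (closed_loop f kappa (x t))).
  - apply/near_normP; exists (Num.min (t - a) (b - t)).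
      by rewrite lt_min; lra.
    move=> s; rewrite lt_min !ltr_norml => sab.
    by apply: closed_loop_mode_cst => //; lra.
  - exact/dV/Xx.
  - exact: (ae_solution_derive cF acx).
apply: (@ler0_derive1_nincr _ (V \o x) a b) => //.
- by move=> t; rewrite in_itv/= => /dVx[].
- move=> t; rewrite in_itv/= => tab; rewrite derive1E.
  by have [_ ->] := dVx _ tab; exact: Vx.
- apply: (within_continuous_comp (abs_continuous_within acx) cV) => t /=.
  by rewrite in_itv/=; exact: Xx.
Qed.

End ClosedLoopFlow.

(** * Hybrid time domains *)

(** Truncation at [(T, J)] keeps exactly the levels up to [J], the last one ending at [T]; the
    breakpoints [t] support the later inductions over jumps. *)
Lemma hybrid_time_domainP (R : realType) (E : set (R * nat)) (T : R) (J : nat) :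
  hybrid_time_domain E -> E (T, J) -> exists t : nat -> R,
    [/\ t 0%N = 0, t J.+1 = T,
        forall j, (j <= J)%N -> t j <= t j.+1 &
        forall j s, (j <= J)%N -> (E (s, j) /\ s <= T) <-> (t j <= s <= t j.+1)].
Proof.
move=> [E0 hE] ETJ; have [J' [t [t0 tj tE]]] := hE _ _ ETJ.
have EP s j : (j <= J)%N -> (E (s, j) /\ s <= T) <->
    (j < J')%N /\ t j <= s <= t j.+1.
  move=> jJ; have := congr1 (fun D => D (s, j)) tE => /=; rewrite propeqE.
  rewrite /bigcup /setI /setX /= in_itv/= => h; split.
    move=> [Es sT]; have [|i iJ' [/= + ij]] := h.1; last by rewrite ij in_itv.
    by split => //; rewrite (E0 _ Es).
  move=> [jJ' ts]; have [|Es [/= /andP[_ sT] _]] := h.2 => //.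
  by exists j => //=; rewrite in_itv/=.
have [JJ' _] : (J < J')%N /\ t J <= T <= t J.+1 by apply/(EP _ _ (leqnn J)).
(* A further level would put [(t J.+1, J.+1)] in the truncated domain, whose levels are at most
   [J]. *)
have JE : J' = J.+1.
  apply/eqP; rewrite eqn_leq JJ' andbT leqNgt; apply/negP => lt.
  have := congr1 (fun D => D (t J.+1, J.+1)) tE => /=; rewrite propeqE => -[_ h].
  have [|_ [_ /=]] := h; last by rewrite ltnn.
  by exists J.+1 => //=; split => //=; rewrite in_itv/= lexx tj.
exists t; split => //.
- have [|_ tT] := (EP (t J.+1) J (leqnn _)).2.
    by rewrite lexx tj.
  have [_ /andP[_ Tt]] := (EP T J (leqnn _)).1 (conj ETJ (lexx _)).
  by apply/eqP; rewrite eq_le tT.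
- by move=> j jJ; apply: tj; rewrite JE ltnS.
- move=> j s jJ; rewrite EP//; split => [[]//|]; split => //.
  by rewrite JE ltnS.
Qed.

Lemma hybrid_time_domain_itv (R : realType) (E : set (R * nat)) (a b : R)
    (j : nat) :
  hybrid_time_domain E -> E (a, j) -> E (b, j) -> forall s, a <= s <= b ->
  E (s, j).
Proof.
move=> hE Ea Eb s /andP[as_ sb].
have [t [_ tT _ tE]] := hybrid_time_domainP hE Eb.
have [|ta _] := andP ((tE j a (leqnn _)).1 _).
  by split => //; exact: le_trans sb.
have [] // := (tE j s (leqnn _)).2.
by rewrite (le_trans ta as_) tT.
Qed.

Lemma closed_within_le (R : realType) (W : normedModType R) (X : set W)
    (g h : W -> R) :
  closed X -> {within X, continuous g} -> {within X, continuous h} ->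
  closed (X `&` [set x | g x <= h x]).
Proof.
move=> cX /within_continuousP cg /within_continuousP ch x clx.
have Xx : X x by apply: cX => B /clx[y [[Xy _] By]]; exists y.
split => //=; rewrite leNgt; apply/negP => hg.
have e0 : 0 < (g x - h x) / 2 by lra.
have near_x : \forall y \near x,
    (X y -> `|g y - g x| < (g x - h x) / 2) /\
    (X y -> `|h y - h x| < (g x - h x) / 2).
  by apply: filterI; [exact: cg|exact: ch].
have [y [[Xy /= gh] [/(_ Xy) gy /(_ Xy) hy]]] := clx _ near_x.
by move: gy hy; rewrite !ltr_norml; lra.
Qed.

(** * The closed-loop system *)

Section ClosedLoop.
Context (R : realType) (n m : nat) (Q : {fset R}).
Context (X A Y : set (R * 'rV[R]_n)).
Context (f : (R * 'rV[R]_n) * 'rV[R]_m -> 'rV[R]_n).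
Context (delta V : R * 'rV[R]_n -> R) (kappa : R * 'rV[R]_n -> 'rV[R]_m).
Hypothesis X_closed : closed X.
Hypothesis X_sub : forall x, X x -> x.1 \in Q.
Hypothesis X_fiber : fiber_closed Q X.
Hypothesis f_cont : {within X `*` [set: 'rV[R]_m], continuous f}.
Hypothesis YX : Y `<=` X.
Hypothesis AY : A `<=` Y.
Hypothesis delta_cont : {within X, continuous delta}.
Hypothesis delta_ge0 : forall x, X x -> 0 <= delta x.
Hypothesis delta_gt0 : forall x, (X `\` A) x -> 0 < delta x.
Hypothesis candidate : slff_candidate Q X f A Y V kappa.

Local Notation C := (Cset Q X V delta).
Local Notation F := (closed_loop f kappa).

Let X_fiber2 x s : X x -> s \in Q -> X (s, x.2).
Proof. by case: x => q z; exact: X_fiber. Qed.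

Let V_ge0 x : X x -> 0 <= V x.
Proof. by case: candidate => -[_ + _ _ _ _]; exact. Qed.

Let V_cont : {within X, continuous V}.
Proof. by case: candidate => -[+ _ _ _ _ _]; exact: C1_within_continuous. Qed.

Let V_diff x : X x -> differentiable (fun z => V (x.1, z)) x.2.
Proof.
case: candidate => -[[U [_ XU dV _]] _ _ _ _ _] Xx.
by apply: dV; split; [exact: XU|exact: X_sub].
Qed.

Let F_cont : {within X, continuous F}.
Proof. by case: candidate => *; exact: within_continuous_closed_loop. Qed.

Let V_eq0 x : X x -> V x = 0 -> A x.
Proof. by case: candidate => _ _ _ + _ Xx V0 => /(_ x Xx)[+ _]; exact. Qed.

Let A_V0 x : A x -> V x = 0.
Proof.
by case: candidate => _ _ _ + _ Ax => /(_ x (YX (AY Ax)))[_]; exact.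
Qed.

Let V_gt0 x : X x -> ~ A x -> 0 < V x.
Proof.
move=> Xx nA; rewrite lt_neqAle V_ge0// andbT eq_sym.
by apply/eqP => /(V_eq0 Xx).
Qed.

Lemma sublevel_compact c : compact (X `&` [set x | V x <= c]).
Proof.
have [c0|c0] := leP 0 c; first by case: candidate => _ _ + _ _; exact.
suff -> : X `&` [set x | V x <= c] = set0 by exact: compact0.
by apply/seteqP; split => // x [/V_ge0 + /=]; lra.
Qed.

Lemma min_modes_cont : {within X, continuous (min_modes Q V)}.
Proof. exact: within_continuous_min_modes. Qed.

Lemma Cset_closed : closed C.
Proof.
apply: closed_within_le => // x.
by apply: continuousB; [exact: V_cont|exact: min_modes_cont].
Qed.

Lemma sub_Cset : A `<=` C.
Proof.
move=> x Ax; have Xx := YX (AY Ax); split => //=.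
apply: le_trans (delta_ge0 Xx); rewrite muE A_V0// sub0r oppr_le0.
have [s sQ ->] := min_modes_ex V (X_sub Xx).
by apply: V_ge0; exact: X_fiber2 Xx sQ.
Qed.

(** On the compact set where [V <= 1], a point outside [A] keeps [V] above half its value nearby,
    while a point of [A] has only neighbours close to [A]; compactness makes the threshold
    uniform. *)
Lemma sublevel_near e : 0 < e ->
  exists2 c, 0 < c & forall x, X x -> V x <= c -> (edist_inf A x <= e%:E)%E.
Proof.
move=> e0.
have [d d0 dP] : exists2 d, 0 < d & forall x, (X `&` [set x | V x <= 1]) x ->
    X x -> V x <= d -> (edist_inf A x <= e%:E)%E.
  apply: (compact_near_pos (P := fun d x => X x -> V x <= d ->
    (edist_inf A x <= e%:E)%E) (@sublevel_compact 1)) => k [Xk _].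
  have [Ak|nAk] := pselect (A k).
    exists 1 => //; apply/near_normP; exists e => // x xk d _ _ _.
    by apply/ltW/edist_inf_ltP; exists k.
  have Vk := V_gt0 Xk nAk; exists (V k / 2); first by rewrite divr_gt0.
  move/within_continuousP : V_cont => /(_ k Xk (V k / 2)).
  rewrite divr_gt0// => /(_ isT); apply: filterS => x Vx d /andP[d0 dV] Xx Vd.
  by exfalso; move: (Vx Xx); rewrite ltr_norml; lra.
exists (Num.min d 1); first by rewrite lt_min d0 ltr01.
by move=> x Xx; rewrite le_min => /andP[xd x1]; exact: dP.
Qed.

(** This is the fixed cost of a jump. In the compact sublevel set, points with [c <= V] lie outside
    [A], where [delta] is positive; around the other points [c <= V] fails. *)
Lemma delta_lower c v : 0 < c ->
  exists2 d, 0 < d & forall x, X x -> c <= V x -> V x <= v -> d <= delta x.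
Proof.
move=> c0.
have [d d0 dP] : exists2 d, 0 < d & forall x, (X `&` [set x | V x <= v]) x ->
    X x -> c <= V x -> d <= delta x.
  apply: (compact_near_pos (P := fun d x => X x -> c <= V x -> d <= delta x)
    (@sublevel_compact v)) => k [Xk _].
  have [ck|kc] := leP c (V k).
    have dk : 0 < delta k.
      by apply: delta_gt0; split => // /A_V0 V0; move: ck; rewrite V0; lra.
    exists (delta k / 2); first by rewrite divr_gt0.
    move/within_continuousP : delta_cont => /(_ k Xk (delta k / 2)).
    rewrite divr_gt0// => /(_ isT); apply: filterS => x dx d dd Xx _.
    by move: (dx Xx); rewrite ltr_norml; lra.
  exists 1 => //; move/within_continuousP : V_cont => /(_ k Xk (c - V k)).
  rewrite subr_gt0 => /(_ kc); apply: filterS => x Vx d _ Xx cx.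
  by move: (Vx Xx); rewrite ltr_norml; lra.
by exists d => // x Xx cx xv; exact: dP.
Qed.

(** * Consequences of the synergy gap *)

Section Gap.
Hypothesis gap : gap_exceeds Q X f A Y V kappa delta.

Lemma Cset_sub : C `<=` Y.
Proof.
move=> x [Xx /= mux]; apply: contrapT => nY.
have := @gap x; rewrite ltNge mux => gx; apply: notF; apply: gx.
split; last by move/AY.
by right; exact: subset_closure.
Qed.

Let Vdot_le0 x : C x -> Vdot f V kappa x <= 0.
Proof. by move/Cset_sub; case: candidate => _ _ _ _; exact. Qed.

(** LaSalle's invariance argument for a flow without jumps. *)
Lemma no_flow_above c a (x : R -> R * 'rV[R]_n) : 0 < c ->
  (forall b, abs_continuous a b x) ->
  {ae @lebesgue_measure R, forall t, a <= t -> is_derive t 1 x (F (x t))} ->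
  (forall t, a <= t -> C (x t)) -> (forall t, a <= t -> c <= V (x t)) -> False.
Proof.
move=> c0 acx aex Cx cx.
have Xx t : a <= t -> X (x t) by move=> /Cx[].
have aexb s b : a <= s -> {ae @lebesgue_measure R, forall t, s <= t <= b ->
    is_derive t 1 x (F (x t))}.
  by move=> as_; apply: ae_itv aex => t /= /andP[st _]; exact: le_trans st.
have Vx s t : a <= s -> s <= t -> V (x t) <= V (x s).
  move=> as_ st; apply: (@flow_nonincreasing _ _ _ f kappa x s t _ _ X V) => //.
  - exact: abs_continuous_sub (acx t).
  - exact: aexb.
  - by move=> u /andP[su _]; apply: Xx; exact: le_trans su.
  - by move=> u /andP[su _]; apply: Vdot_le0; apply: Cx; lra.
(* Intersecting with the closed set [C] keeps the limits of translates among the states where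
   [mu <= delta]. *)
pose K := C `&` (X `&` [set y | V y <= V (x a)]).
have cK : compact K.
  apply: subclosed_compact (@sublevel_compact (V (x a))) _; last by move=> y [].
  apply: closedI; first exact: Cset_closed.
  by apply: compact_closed (@sublevel_compact _); exact: norm_hausdorff.
have KX : K `<=` X by move=> y [_ []].
have Kx t : a <= t -> K (x t).
  by move=> at_; split; [exact: Cx|split; [exact: Xx|exact: Vx]].
have [y [Ky dy [L Ly] yx]] := ode_limit_solution F_cont cK KX acx aex Kx.
pose S := [set V (x t) | t in [set t | a <= t]].
have S0 : has_inf S.
  by split; [exists (V (x a)), a => /=|exists c => _ [t /= at_ <-]; exact: cx].
(* [V] is nonincreasing along [x], which comes arbitrarily close to [y s] at arbitrarily late times;
   continuity then forces the value at [y s]. *)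
have Vy s : V (y s) = inf S.
  have [_ [Xy _]] := Ky s; apply/eqP; rewrite -subr_eq0 -normr_le0.
  apply/ler_addgt0Pr => e e0; rewrite add0r.
  have e20 : 0 < e / 2 by rewrite divr_gt0.
  have [_ [u /= au <-] ue] := inf_adherent e20 S0.
  move/within_continuousP : V_cont => /(_ _ Xy _ e20) /near_normP[r r0 rP].
  have [t ut ty] := yx s r u r0.
  have at_ : a <= t by exact: le_trans ut.
  have St : inf S <= V (x t) by apply: ge_inf; [case: S0|exists t].
  have tu := Vx u t au ut.
  have := rP _ ty (Xx _ at_); rewrite ltr_norml ler_norml.
  by lra.
(* Stating [g] through an equation covers the translates of [y] and, with [h = 0], [y] itself. *)
have acy b d (g : R -> R * 'rV[R]_n) (h : R) : g = (fun t => y (h + t)) ->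
    abs_continuous b d g.
  move=> ->; apply: (@lipschitz_abs_continuous _ _ _ _ L) => s t _ st _.
  by have := Ly (h + s) (h + t); rewrite lerD2l opprD addrACA subrr add0r; exact.
have dyh (h t : R) : is_derive t 1 (fun s => y (h + s)) (F (y (h + t))).
  apply/is_derive1P => e e0; have /is_derive1P/(_ e e0)[r r0 rP] := dy (h + t).
  exists r => // s st; have := rP (h + s).
  by rewrite opprD addrACA subrr add0r; exact.
(* [V \o y] is constant and has derivative [Vdot] along [y], which therefore vanishes. *)
have Ey s : zero_dissipation_set f Y V kappa (y s).
  have [Cy [Xy _]] := Ky s; split; first exact: Cset_sub.
  have ys : \forall u \near s, (y u).1 = (y s).1.
    apply/near_normP; exists 1 => // u; rewrite ltr_norml => us.
    have ae1 : {ae @lebesgue_measure R, forall t, s - 1 <= t <= s + 1 ->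
        is_derive t 1 y (F (y t))} by exact: aeW.
    apply: (closed_loop_mode_cst _ ae1); try lra.
    by apply: (acy _ _ _ 0); apply/funext => t; rewrite add0r.
  have [_] := is_derive1_comp_grad ys (V_diff Xy) (dy s).
  rewrite (_ : V \o y = cst (inf S)); last by apply/funext => u; exact: Vy.
  by rewrite derive_cst => /esym.
have solution (h : R) (I : set R) :
    ode_solution F (zero_dissipation_set f Y V kappa) I (fun t => y (h + t)).
  split; first by move=> b d _; exact: acy.
  - by apply: aeW => t _; exact: dyh.
  - by move=> t _; exact: Ey.
(* As [y] lives on the whole line, its translate by [s] is a forward solution from [y s], and its
   translate by [s - N] a backward one with [T = N]. *)
have Psi_y : Psi f Y V kappa (y 0).
  exists (range y); last by exists 0.
  split; first by move=> _ [s _ <-].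
    move=> _ [s _ <-]; exists (fun t => y (s + t)); split => //.
    by rewrite addr0.
  move=> _ N [s _ <-] N0; exists N, (fun t => y (s - N + t)); split => //.
  by rewrite subrK.
have [[Xy /= mud] _] := Ky 0.
have := @gap (y 0); rewrite ltNge mud => gx; apply: notF; apply: gx.
split; first by left.
move=> /A_V0; rewrite Vy => infS; suff : c <= inf S by lra.
by apply: lb_le_inf; [case: S0|move=> _ [t /= at_ <-]; exact: cx].
Qed.

Local Notation H := (closed_loop_hybrid Q X f V kappa delta).

(** * Hybrid arcs *)

Section Arc.
Context (E : set (R * nat)) (phi : R -> nat -> R * 'rV[R]_n).
Hypothesis sol : hybrid_solution H E phi.

Let htd : hybrid_time_domain E. Proof. by case: sol. Qed.

Let arc_ac a b j : E (a, j) -> E (b, j) -> abs_continuous a b (phi ^~ j).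
Proof.
move=> Ea Eb; case: sol => _ _ lac _ _; apply: lac => t /=; rewrite in_itv/=.
exact: hybrid_time_domain_itv.
Qed.

Lemma arc_flow_set a b j t : E (a, j) -> E (b, j) -> a < b -> a <= t <= b ->
  C (phi t j).
Proof.
move=> Ea Eb ab; apply: (closed_of_interior Cset_closed ab (arc_ac Ea Eb)) => s sab.
case: sol => _ _ _ /(_ j)[+ _] _; apply.
apply/(near_normP s [set u | E (u, j)]); exists (Num.min (s - a) (b - s)).
  by rewrite lt_min; lra.
move=> u; rewrite lt_min !ltr_norml => us.
by apply: (hybrid_time_domain_itv htd Ea Eb); lra.
Qed.

(** For [a = b] no flow places the state in [C], hence the hypothesis on [phi a j]. *)
Lemma arc_flow a b j : E (a, j) -> E (b, j) -> a <= b -> X (phi a j) ->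
  X (phi b j) /\ V (phi b j) <= V (phi a j).
Proof.
move=> Ea Eb; rewrite le_eqVlt => /orP[/eqP <-//|ab] Xa.
have Cab t : a <= t <= b -> C (phi t j) by exact: arc_flow_set.
split; first by have [] := Cab b; rewrite // lexx ltW.
apply: (@flow_nonincreasing _ _ _ f kappa (phi ^~ j) a b _ _ X V) => //.
- exact: arc_ac.
- case: sol => _ _ _ /(_ j)[_ aej] _; apply: ae_itv aej => t /=.
  exact: hybrid_time_domain_itv.
- by move=> t /Cab[].
- by move=> t tab; apply/Vdot_le0/Cab; lra.
- exact: ltW.
Qed.

Lemma arc_jump t j : E (t, j) -> E (t, j.+1) ->
  [/\ X (phi t j.+1), V (phi t j.+1) = min_modes Q V (phi t j) &
      V (phi t j.+1) + delta (phi t j) <= V (phi t j)].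
Proof.
move=> Ej Ej1; case: sol => _ _ _ _ /(_ t j Ej Ej1)[[Xj /= dmu]].
case: (phi t j.+1) => g z /= [[gQ mug] /= zE]; rewrite {z}zE in mug *.
have Xg : X (g, (phi t j).2) by exact: X_fiber2.
(* The minima before and after the jump have different seeds, but both are attained at modes of [Q]
   over the same [z]; two inequalities identify them. *)
have Vg : V (g, (phi t j).2) = min_modes Q V (phi t j).
  move: mug; rewrite muE => /eqP; rewrite subr_eq0 => /eqP VE.
  have [s sQ sE] := min_modes_ex V (X_sub Xj).
  have [s' s'Q s'E] := min_modes_ex V (gQ : (g, (phi t j).2).1 \in Q).
  apply/eqP; rewrite eq_le {1}VE sE (min_modes_le V (g, (phi t j).2) sQ)/=.
  by rewrite -sE (min_modes_le V (phi t j) gQ).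
by split => //; move: dmu; rewrite muE Vg; lra.
Qed.

Lemma arc_times T J : E (T, J) -> exists t : nat -> R,
  [/\ t 0%N = 0 /\ t J.+1 = T,
      forall j, (j <= J)%N -> t j <= t j.+1,
      forall j, (j <= J)%N -> t j.+1 <= T,
      forall j s, (j <= J)%N -> t j <= s <= t j.+1 -> E (s, j) &
      forall j s, (j <= J)%N -> E (s, j) -> s <= T -> t j <= s <= t j.+1].
Proof.
move=> ETJ; have [t [t0 tT tj tE]] := hybrid_time_domainP htd ETJ.
exists t; split => // [j jJ|j s jJ ts|j s jJ Es sT].
- by have [] := (tE j (t j.+1) jJ).2; rewrite // lexx tj.
- by have [] := (tE j s jJ).2 ts.
- exact/tE.
Qed.

Lemma arc_state T J : E (T, J) -> X (phi T J).
Proof.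
move=> ETJ; have [t [[t0 tT] tj _ tE _]] := arc_times ETJ.
have Xt j : (j <= J)%N -> X (phi (t j) j).
  elim: j => [_|j IH jJ].
    (* Initially the state lies in [closure C] or in the jump set; [C] being closed, both are inside
       [X]. *)
    case: sol => _ [_]; rewrite t0 => -[clC|[]//] _ _ _.
    by have [] := Cset_closed clC.
  have jJ' := ltnW jJ.
  have Ej1 : E (t j.+1, j) by apply: tE; rewrite // lexx tj.
  have Ej : E (t j, j) by apply: tE; rewrite // lexx tj.
  have Ejj : E (t j.+1, j.+1) by apply: tE; rewrite // lexx tj.
  by have [] := arc_jump Ej1 Ejj.
have EJ : E (t J, J) by apply: tE; rewrite // lexx tj.
have tJ : t J <= T by rewrite -tT tj.
by have [] := arc_flow EJ ETJ tJ (Xt _ (leqnn J)).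
Qed.

Lemma arc_nonincreasing s i T J : E (s, i) -> E (T, J) -> s <= T ->
  (i <= J)%N -> V (phi T J) <= V (phi s i).
Proof.
move=> Es ETJ sT iJ; have [t [[_ tT] tj _ tE Et]] := arc_times ETJ.
have Ej j : (j <= J)%N -> E (t j, j) by move=> jJ; apply: tE; rewrite // lexx tj.
have Ej1 j : (j <= J)%N -> E (t j.+1, j).
  by move=> jJ; apply: tE; rewrite // lexx tj.
(* Induction on the number [k] of jumps after level [i], with comparison at the right end of each
   level. *)
have Vi k : (i + k <= J)%N -> V (phi (t (i + k).+1) (i + k)) <= V (phi s i).
  elim: k => [_|k IH]; rewrite ?addn0.
    have /andP[_ sti] := Et i s iJ Es sT.
    by have [] := arc_flow Es (Ej1 i iJ) sti (arc_state Es).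
  rewrite addnS => ikJ; apply: le_trans (IH (ltnW ikJ)).
  have Ek := Ej1 _ (ltnW ikJ); have Ek1 := Ej _ ikJ.
  have [Xk1 _ Vk] := arc_jump Ek Ek1.
  have [_ Vf] := arc_flow Ek1 (Ej1 _ ikJ) (tj _ ikJ) Xk1.
  by have := delta_ge0 (arc_state Ek); lra.
by have := Vi (J - i)%N; rewrite subnKC// tT; exact.
Qed.

(** By monotonicity, [V] lies between [c] and its initial value at every earlier jump, so each jump
    costs at least [d]. *)
Lemma arc_jump_count c d T J :
  (forall x, X x -> c <= V x -> V x <= V (phi 0 0%N) -> d <= delta x) ->
  E (T, J) -> c <= V (phi T J) -> V (phi T J) + J%:R * d <= V (phi 0 0%N).
Proof.
move=> dP ETJ cV; have [t [[t0 tT] tj t_le tE _]] := arc_times ETJ.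
have E00 : E (0, 0%N) by case: sol => _ [].
have Ej j : (j <= J)%N -> E (t j, j) by move=> jJ; apply: tE; rewrite // lexx tj.
have Ej1 j : (j <= J)%N -> E (t j.+1, j).
  by move=> jJ; apply: tE; rewrite // lexx tj.
have Vj j : (j <= J)%N -> V (phi (t j) j) + j%:R * d <= V (phi 0 0%N).
  elim: j => [_|j IH jJ]; first by rewrite t0 mul0r addr0.
  have jJ' := ltnW jJ; have tj0 : 0 <= t j.
    by case: htd => pos _; exact: (pos _ (Ej _ jJ')).
  have Ek := Ej1 _ jJ'; have [_ _ Vk] := arc_jump Ek (Ej _ jJ).
  have [_ Vf] := arc_flow (Ej _ jJ') Ek (tj _ jJ') (arc_state (Ej _ jJ')).
  have cVj : c <= V (phi (t j.+1) j).
    by apply: le_trans cV _; exact: arc_nonincreasing (t_le _ jJ') jJ'.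
  have Vj0 : V (phi (t j.+1) j) <= V (phi 0 0%N).
    by apply: arc_nonincreasing => //; exact: le_trans (tj _ jJ').
  have := dP _ (arc_state Ek) cVj Vj0; have := IH jJ'.
  by rewrite -natr1 mulrDl mul1r; lra.
have := Vj J (leqnn J); have := arc_nonincreasing (Ej J (leqnn J)) ETJ.
by have := tj J (leqnn J); rewrite tT => tJT /(_ tJT (leqnn J)); lra.
Qed.

Lemma arc_eventually_below c : 0 < c -> exists N : R, forall t j, E (t, j) ->
  N <= t + j%:R -> V (phi t j) <= c.
Proof.
move=> c0; apply: contrapT => nN.
have above N : exists t j, [/\ E (t, j), N <= t + j%:R & c < V (phi t j)].
  apply: contrapT => h; apply: nN; exists N => t j Etj Nt.
  by rewrite leNgt; apply/negP => cV; apply: h; exists t, j.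
have [d d0 dP] := delta_lower (V (phi 0 0%N)) c0.
have E00 : E (0, 0%N) by case: sol => _ [].
have V00 : 0 <= V (phi 0 0%N) by exact/V_ge0/arc_state.
pose J0 := Num.bound (V (phi 0 0%N) / d).
have jumps t j : E (t, j) -> c < V (phi t j) -> (j < J0)%N.
  move=> Etj cV; have := arc_jump_count dP Etj (ltW cV).
  have : V (phi 0 0%N) / d < J0%:R by apply: archi_boundP; rewrite divr_ge0// ltW.
  rewrite ltr_pdivrMr// => h1 h2; rewrite -(ltr_nat R) -(ltr_pM2r d0).
  by lra.
(* E may branch, as [0, +oo[ x {0} together with {1} x nat does, so the level J
   is obtained by pigeonhole rather than as the last one. *)
have [J JP] : exists J, forall N, exists2 t, N <= t & E (t, J) /\ c < V (phi t J).
  apply: contrapT => h.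
  have /choice[N NP] j : exists N, forall t, E (t, j) -> N <= t -> V (phi t j) <= c.
    apply: contrapT => hj; apply: h; exists j => N.
    apply: contrapT => hN; apply: hj; exists N => t Etj Nt.
    by rewrite leNgt; apply/negP => cV; apply: hN; exists t.
  (* Since [j < J0], this threshold forces [t] past [N j], whichever level [j] occurs. *)
  have [t [j [Etj Nt cV]]] := above (J0%:R + \sum_(i < J0) `|N i|).
  have jJ := jumps _ _ Etj cV.
  suff : V (phi t j) <= c by rewrite leNgt cV.
  apply: NP => //; have jJr : j%:R <= J0%:R :> R by rewrite ler_nat ltnW.
  have : `|N j| <= \sum_(i < J0) `|N i|.
    by rewrite (bigD1 (Ordinal jJ))//= lerDl sumr_ge0.
  by have := ler_norm (N j); lra.
have [a _ [Ea _]] := JP 0.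
have EJ t : a <= t -> E (t, J).
  move=> at_; have [T tT [ET _]] := JP t.
  by apply: (hybrid_time_domain_itv htd Ea ET); rewrite at_.
apply: (@no_flow_above c a (phi ^~ J) c0).
- move=> b; have [ab|ba] := leP a b.
    by apply: arc_ac; apply: EJ.
  (* For [b < a] only the empty family of intervals qualifies. *)
  move=> e e0; exists 1 => // N s t st _ _; rewrite big1// => i _.
  by have [] := st _ (ltn_ord i); lra.
- by case: sol => _ _ _ /(_ J)[_ aeJ] _; apply: ae_itv aeJ => t; exact: EJ.
- move=> t at_; apply: (@arc_flow_set a (t + 1)) => //; last by lra.
  + by apply: EJ; lra.
  + by lra.
- move=> t at_; have [T tT [ET cV]] := JP t.
  by apply/ltW/(lt_le_trans cV)/arc_nonincreasing => //; exact: EJ.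
Qed.

Lemma arc_attracted e : 0 < e -> exists N : R, forall t j, E (t, j) ->
  N <= t + j%:R -> (edist_inf A (phi t j) <= e%:E)%E.
Proof.
move=> e0; have [c c0 cP] := sublevel_near e0.
have [N NP] := arc_eventually_below c0.
by exists N => t j Etj /(NP _ _ Etj); apply: cP; exact: arc_state.
Qed.

Lemma arc_le_initial t j : E (t, j) -> V (phi t j) <= V (phi 0 0%N).
Proof.
move=> Etj; apply: arc_nonincreasing => //; first by case: sol => _ [].
by case: htd => pos _; exact: (pos _ Etj).
Qed.

Lemma arc_initial_flow t : E (t, 0%N) -> t != 0 -> C (phi 0 0%N).
Proof.
move=> Et t0; have E00 : E (0, 0%N) by case: sol => _ [].
have tge0 : 0 <= t by case: htd => pos _; exact: (pos _ Et).
by apply: (arc_flow_set E00 Et); rewrite ?lexx// lt_neqAle eq_sym t0.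
Qed.

(** Outside [C] no time can elapse at level [0]: the first jump happens at time [0] and brings [V]
    to its minimum over the modes, after which [V] cannot increase. *)
Lemma arc_initial_jump t j : ~ C (phi 0 0%N) -> E (t, j.+1) ->
  V (phi t j.+1) <= min_modes Q V (phi 0 0%N).
Proof.
move=> nC Et; have [u [[u0 _] uj _ uE _]] := arc_times Et.
have E00 : E (0, 0%N) by case: sol => _ [].
have E1 : E (u 1%N, 0%N) by apply: uE; rewrite // lexx uj.
have u1 : u 1%N = 0 by apply: contrapT => /eqP/(arc_initial_flow E1).
have E01 : E (0, 1%N) by rewrite -u1; apply: uE; rewrite // lexx uj.
have [_ <- _] := arc_jump E00 E01.
by apply: arc_nonincreasing => //; case: htd => pos _; exact: (pos _ Et).
Qed.

End Arc.

(** * Global asymptotic stability of the two compact sets *)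

Lemma min_modes_B x : Bset Q X A x -> min_modes Q V x = 0.
Proof.
move=> [Xx [s sQ Asx]]; apply/eqP; rewrite eq_le -{1}(A_V0 Asx) min_modes_le//=.
have [s' s'Q ->] := min_modes_ex V (X_sub Xx).
by apply: V_ge0; exact: X_fiber2.
Qed.

(** For stability, a sublevel set of [V] fits within distance [e] of [A] and contains the states of
    [X] within some distance [d] of [A]; monotonicity of [V] traps the arc in it. *)
Lemma gas_A : compact A -> globally_asymptotically_stable H A.
Proof.
move=> cA; split => //.
- move=> e e0; have [c c0 cP] := sublevel_near e0.
  have near_A k : A k -> \forall x \near k, X x -> V x <= c.
    move=> Ak; have Xk := YX (AY Ak).
    move/within_continuousP : V_cont => /(_ k Xk c c0); apply: filterS => x Vx Xx.
    by move: (Vx Xx); rewrite (A_V0 Ak) subr0 => /ltW;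
    exact: le_trans (ler_norm _).
  have [d d0 dP] := compact_near_edist cA near_A.
  exists d => // E phi sol phi0 t j Etj; have E00 : E (0, 0%N) by case: sol => _ [].
  apply: cP; first exact: (arc_state sol).
  apply: le_trans (arc_le_initial sol Etj) _; apply: dP phi0 _.
  exact: (arc_state sol).
- move=> E phi sol.
  have [M _ MP] := compact_norm_le (@sublevel_compact (V (phi 0 0%N))).
  exists M => t j Etj; apply: MP; split; first exact: (arc_state sol).
  exact: (arc_le_initial sol Etj).
- by move=> E phi sol _ e e0; exact: (arc_attracted sol e0).
Qed.

Lemma A_sub_B : A `<=` Bset Q X A.
Proof.
move=> x Ax; have Xx := YX (AY Ax); split => //.
by exists x.1; [exact: X_sub|rewrite -surjective_pairing].
Qed.

Lemma edist_inf_sub (K K' : set (R * 'rV[R]_n)) x (e : R) : K `<=` K' ->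
  (edist_inf K x <= e%:E)%E -> (edist_inf K' x <= e%:E)%E.
Proof.
move=> KK'; apply: le_trans; apply: ereal_inf_le_tmp.
by move=> _ [k Kk <-]; exists k => //; exact: KK'.
Qed.

(** The set is closed in a finite union, over the modes [q], of the images of [A] when its mode is
    replaced by [q]. *)
Lemma compact_B : compact A -> compact (Bset Q X A).
Proof.
move=> cA.
have cU (l : seq R) : compact [set x | x.1 \in l /\ exists s, A (s, x.2)].
  elim: l => [|q l IH].
    suff -> : [set x | x.1 \in ([::] : seq R) /\ exists s, A (s, x.2)] = set0.
      exact: compact0.
    by apply/seteqP; split => // x [].
  have -> : [set x | x.1 \in q :: l /\ exists s, A (s, x.2)] =
      (fun y : R * 'rV[R]_n => (q, y.2)) @` A `|`
      [set x | x.1 \in l /\ exists s, A (s, x.2)].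
    apply/seteqP; split => [[p z] /= [+ [s As]]|[p z] /= [[y Ay [<- <-]]|[pl As]]].
    - rewrite inE => /orP[/eqP->|pl]; first by left; exists (s, z).
      by right; split; last exists s.
    - by split; [exact: mem_head|exists y.1; rewrite -surjective_pairing].
    - by split => //; rewrite inE pl orbT.
  apply: compactU IH; apply: continuous_compact cA.
  apply/within_continuousP => x _ e e0; apply/near_normP; exists e => // y yx _.
  rewrite prod_normE/= subrr normr0 gt_max e0/=.
  exact: le_lt_trans (norm_snd_le (y - x)) yx.
have -> : Bset Q X A = X `&` [set x | x.1 \in (Q : seq R) /\ exists s, A (s, x.2)].
  apply/seteqP; split => x [Xx /=].
    by move=> [s sQ As]; split => //; split; [exact: X_sub|exists s].
  by move=> [_ [s As]]; split => //; exists s => //; exact: X_sub (YX (AY As)).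
apply: subclosed_compact (cU Q) _; last by move=> x [].
by apply: closedI => //; apply: compact_closed (cU Q); exact: norm_hausdorff.
Qed.

End Gap.

Lemma gap_totally_exceedsW : gap_totally_exceeds Q X f A Y V kappa delta ->
  gap_exceeds Q X f A Y V kappa delta.
Proof. by move=> gap x [gx nA]; apply: gap; split => //; left. Qed.

(** Boundedness and attractivity carry over from [A], a subset of [Bset Q X A]; only stability calls
    for a new argument. *)
Lemma gas_B : gap_totally_exceeds Q X f A Y V kappa delta -> compact A ->
  globally_asymptotically_stable (closed_loop_hybrid Q X f V kappa delta)
    (Bset Q X A).
Proof.
move=> tgap cA; have gap := gap_totally_exceedsW tgap.
have [_ _ bounded attractive] := gas_A gap cA.
have cB := compact_B cA.
have CB x : C x -> Bset Q X A x -> A x.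
  move=> [Xx /= mux] Bx; apply: contrapT => nA.
  have := @tgap x; rewrite ltNge mux => tx; apply: notF; apply: tx.
  by split => //; right.
split => // [e e0|E phi sol cE e e0]; last first.
  have [N NP] := attractive E phi sol cE e e0.
  by exists N => t j Etj Nt; apply: edist_inf_sub A_sub_B _; exact: NP.
have [c c0 cP] := sublevel_near e0.
(* If [k] is in [C], it is in [A] and [V k = 0]; otherwise a neighbourhood of [k] misses the closed
   set [C], and the second clause is vacuous there. *)
have near_B k : Bset Q X A k -> \forall x \near k,
    (X x -> min_modes Q V x <= c) /\ (C x -> V x <= c).
  move=> Bk; have [Xk _] := Bk; apply: filterI.
    move/within_continuousP : min_modes_cont => /(_ k Xk c c0).
    apply: filterS => x Vx Xx; move: (Vx Xx).
    by rewrite (min_modes_B Bk) subr0 => /ltW; exact: le_trans (ler_norm _).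
  have [Ck|nCk] := pselect (C k).
    move/within_continuousP : V_cont => /(_ k Xk c c0).
    apply: filterS => x Vx [Xx _]; move: (Vx Xx).
    by rewrite (A_V0 (CB _ Ck Bk)) subr0 => /ltW; exact: le_trans (ler_norm _).
  have oC : open (~` C) by exact/closed_openC/Cset_closed.
  by have := open_nbhs_nbhs (conj oC nCk); apply: filterS => x nCx /nCx.
have [d d0 dP] := compact_near_edist cB near_B.
(* The bound [e] serves the initial state itself: outside [C], [V] may be large there before the
   immediate jump. *)
exists (Num.min d e); first by rewrite lt_min d0.
move=> E phi sol phi0 t j Etj.
have /dP[Vmin VC] : (edist_inf (Bset Q X A) (phi 0%R 0%N) <= d%:E)%E.
  by apply: le_trans phi0 _; rewrite lee_fin ge_min lexx.
have X0 : X (phi 0 0%N) by apply: (arc_state gap sol); case: sol => _ [].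
have below_c : V (phi t j) <= c -> (edist_inf (Bset Q X A) (phi t j) <= e%:E)%E.
  move=> Vc; apply: edist_inf_sub A_sub_B _; apply: cP Vc.
  exact: (arc_state gap sol).
have [C0|nC0] := pselect (C (phi 0 0%N)).
  by apply: below_c; apply: le_trans (arc_le_initial gap sol Etj) (VC C0).
case: j Etj below_c => [|j] Etj below_c.
  have -> : t = 0.
    by apply: contrapT => /eqP t0; apply: nC0; exact: (arc_initial_flow sol Etj t0).
  by apply: le_trans phi0 _; rewrite lee_fin ge_min lexx orbT.
by apply: below_c; apply: le_trans (arc_initial_jump gap sol nC0 Etj) (Vmin X0).
Qed.

End ClosedLoop.

Theorem theorem2 (R : realType) (n m : nat) (Q : {fset R})
  (X A Y : set (R * 'rV[R]_n))
  (f : (R * 'rV[R]_n) * 'rV[R]_m -> 'rV[R]_n)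
  (delta V : R * 'rV[R]_n -> R) (kappa : R * 'rV[R]_n -> 'rV[R]_m)
  (X_closed : closed X)
  (X_sub : forall x, X x -> x.1 \in Q)
  (* makes min_{s in Q} V(s, z) meaningful for V defined on X *)
  (X_fiber : fiber_closed Q X)
  (f_cont : {within X `*` [set: 'rV[R]_m], continuous f})
  (Y_closed : closed Y) (YX : Y `<=` X)
  (A_compact : compact A) (AY : A `<=` Y)
  (delta_cont : {within X, continuous delta})
  (delta_ge0 : forall x, X x -> 0 <= delta x)
  (delta_gt0 : forall x, (X `\` A) x -> 0 < delta x)
  (VK : slff_pair Q X f A Y V kappa) :
  (gap_exceeds Q X f A Y V kappa delta ->
     A `<=` Cset Q X V delta /\
     globally_asymptotically_stable
       (closed_loop_hybrid Q X f V kappa delta) A) /\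
  (gap_totally_exceeds Q X f A Y V kappa delta ->
     A `<=` Cset Q X V delta /\
     globally_asymptotically_stable
       (closed_loop_hybrid Q X f V kappa delta) (Bset Q X A)).
Proof.
have [candidate _] := VK.
have AC : A `<=` Cset Q X V delta.
  exact: (sub_Cset X_sub X_fiber YX AY delta_ge0 candidate).
split=> gap; split => //.
- exact: (gas_A X_closed X_sub X_fiber f_cont YX AY delta_cont delta_ge0
    delta_gt0 candidate gap A_compact).
- exact: (gas_B X_closed X_sub X_fiber f_cont YX AY delta_cont delta_ge0
    delta_gt0 candidate gap A_compact).
Qed.
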